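(* Consider a network with $T$-periodic external inflows $\lambda(t)$ and $T$-periodic capacity functions $c(t)$, nonnegative, piecewise constant over a period, and satisfying the stability condition. Let $(x^*,z^* )$ be the unique $T$-periodic trajectory of the traffic flow model, and let $(x^{(k)},z^{(k)})$ be the iterates of the iterative network algorithm (both described in the context). Then, as $k\to\infty$, the iterates converge monotonically to the periodic orbit: for every $i\in\mathcal E$ and $t\in[0,T]$, the sequences $x_i^{(k)}(t)$ and $z_i^{(k)}(t)$ are nondecreasing in $k$, with $x_i^{(k)}(t)\to x_i^*(t)$ and $z_i^{(k)}(t)\to z_i^*(t)$.
   Context: Road network: a finite directed multigraph $\mathcal G=(\mathcal V,\mathcal E)$ without self-loops; $\mathcal E$ is the set of links. $R\in\mathbb{R}_{\ge0}^{\mathcal E\times\mathcal E}$ is the routing matrix: $R_{ji}$ is the fraction of the flow leaving link $j$ that goes to link $i$, with $R_{ji}=0$ if $i$ is not immediately downstream of $j$. $R$ is sub-stochastic: nonnegative entries, all row sums at most $1$, at least one row sum strictly less than $1$. Standing connectivity assumption: (i) for every $i,j\in\mathcal E$ there is a directed path from $i$ to $j$ or from $j$ to $i$; (ii) for every $i\in\mathcal E$, either the $i$-th row sum of $R$ is strictly less than $1$, or there is a directed path (along links with consecutive positive entries of $R$) from $i$ to some link $j$ whose row sum in $R$ is strictly less than $1$. In particular the spectral radius of $R$ is strictly less than $1$. $\delta_{ji}\ge0$ is the travel time from link $j$ to link $i$; $\mathcal E_i:=\{j\in\mathcal E:R_{ji}>0,\ \delta_{ji}=0\}$. Piecewise constant: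 finitely many contiguous right-open pieces over a period. Stability condition: there exists $\epsilon>0$ with $[I-R^T]\bar c>\bar\lambda+\epsilon\mathbf 1$ entrywise, where $\bar\lambda_i=\frac1T\int_0^T\lambda_i$, $\bar c_i=\frac1T\int_0^Tc_i$. Traffic flow model: queue lengths $x(t)\in\mathbb{R}_{\ge0}^{\mathcal E}$ satisfy (with $x$ absolutely continuous and the equation holding for almost every $t$) $$\dot x_i(t)=\tilde\lambda_i(t)+\sum_{j\in\mathcal E_i}R_{ji}z_j(t)-z_i(t),\quad i\in\mathcal E,\qquad \tilde\lambda_i(t):=\lambda_i(t)+\sum_{j\in\mathcal E\setminus\mathcal E_i}R_{ji}z_j(t-\delta_{ji}),$$ where for each $t$ the outflow vector $z(t)$ is the (unique, $\eta$-independent) solution of: maximize $\eta^Tz$ over $z\in\mathbb{R}^{\mathcal E}$ subject to $z_i\le c_i(t)$ for all $i\in\mathcal E$ and $z_i\le\tilde\lambda_i(t)+\sum_{j\in\mathcal E_i}R_{ji}z_j$ for all $i$ with $x_i(t)=0$, for any $\eta\in\mathbb{R}_{>0}^{\mathcal E}$. Under the present hypotheses this model has a unique $T$-periodic trajectory $(x^*,z^* )$. Single-link procedure. Given a link with $T$-periodic, piecewise constant inflow $y\ge0$ and capacity $c\ge0$ with $\int_0^Ty<\int_0^Tc$, functions $\mathcal F_x(y,c)=x$ and $\mathcal F_z(y,c)=z$ are computed as follows. If $\{t\in[0,T):y(t)>c(t)\}$ has measure zero, $x\equiv0$. Otherwise let $W^1,\dots,W^{M^w}$ (resp. $B^1,\dots,B^{M^b}$)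 be the maximal intervals of nonzero length in $[0,T)$, in increasing order, on which $y>c$ (resp. $y<c$), with closures $[\underline w^k,\bar w^k]$ (resp. $[\underline b^k,\bar b^k]$). Put $Y(s_1,s_2)=\int_{s_1}^{s_2}y$, $C(s_1,s_2)=\int_{s_1}^{s_2}c$. Set $r_1=1$ and, for $j\ge2$, let $r_j$ be the smallest $n\in\{r_{j-1}+1,\dots,M^w\}$ for which there is $p\in\{1,\dots,M^b\}$ with $\bar b^p\in(\underline w^{n-1},\underline w^n]$ and: $Y(\underline w^{r_{j-1}},\bar b^p)\le C(\underline w^{r_{j-1}},\bar b^p)$ if $\bar b^p<\underline w^n$, or $Y(\underline w^{r_{j-1}},\bar b^p)<C(\underline w^{r_{j-1}},\bar b^p)$ if $\bar b^p=\underline w^n$; stop when no such $n$ exists, and let $r_m$ be the last index obtained. Put $\alpha^L=\underline w^{r_m}$ and $x(0)=\max\{Y(\alpha^L,T)-C(\alpha^L,T),0\}$, and let $x$ on $[0,T]$ be the solution from $x(0)$ of the isolated-link dynamics $\dot x=y-z$, where $z(t)=c(t)$ if $x(t)>0$ and $z(t)=\min\{c(t),y(t)\}$ if $x(t)=0$. In all cases $z$ is given by this same formula, and $x,z$ are extended $T$-periodically. (The function $x$ so obtained is the unique $T$-periodic solution of the isolated-link dynamics.) Network algorithm. Set $y_i^{(1)}(t)=\lambda_i(t)$ for all $i\in\mathcal E$. For $k=1,2,\dots$, and all $i\in\mathcal E$: $x_i^{(k)}=\mathcal F_x(y_i^{(k)},c_i)$, $z_i^{(k)}=\mathcal F_z(y_i^{(k)},c_i)$,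 and $y_i^{(k+1)}(t)=\lambda_i(t)+\sum_{j\in\mathcal E}R_{ji}z_j^{(k)}(t-\delta_{ji})$.
   Formalization: The outflows of the periodic trajectory are additionally required to be nonnegative: the linear program bounds z only from above, and on a cycle with incommensurable delays z could otherwise be altered on a null set, so that uniqueness and pointwise convergence of z would fail. *)

(* Defs.v *)
From HB Require Import structures.
From mathcomp Require Import all_boot all_order all_algebra.
From mathcomp Require Import all_classical all_reals all_analysis.
Set Implicit Arguments.
Unset Strict Implicit.
Unset Printing Implicit Defensive.
Import Order.TTheory GRing.Theory Num.Theory.
Import numFieldNormedType.Exports.
Local Open Scope classical_set_scope.
Local Open Scope ring_scope.

Section RealFunctions.
Context {R : realType}.
Implicit Types (T a b t : R) (f : R -> R).

(* The pieces are the intervals [s_k, s_(k+1)), where the list 0 :: s is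
   0 = s_0 < s_1 < ... < s_n = T. *)
Definition piecewise_constant T f :=
  exists2 s : seq R, itv_partition 0 T s &
    forall k t, (k < size s)%N ->
      nth 0 (0 :: s) k <= t < nth 0 (0 :: s) k.+1 ->
      f t = f (nth 0 (0 :: s) k).

(* A finite family of non-overlapping intervals is listed from left to right. *)
Definition absolutely_continuous a b f :=
  forall e, 0 < e -> exists2 d, 0 < d &
    forall s : seq (R * R),
      all (fun p => (a <= p.1) && (p.1 <= p.2) && (p.2 <= b)) s ->
      pairwise (fun p q => p.2 <= q.1) s ->
      \sum_(p <- s) (p.2 - p.1) < d ->
      \sum_(p <- s) `|f p.2 - f p.1| < e.

Definition integral_over (a b : R) f : R :=
  \int[lebesgue_measure]_(t in `[a, b]) f t.

Definition mean T f : R := T^-1 * integral_over 0 T f.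

(* Extension to the line of the restriction of f to [0, T). *)
Definition periodic_extension T f : R -> R :=
  fun t => f (t - T * (Num.floor (t / T))%:~R).

End RealFunctions.

Section RoadNetwork.
Context {R : realType} {V E : finType}.
Variables (tail head : E -> V) (rt : E -> E -> R).

(* A link e goes from the node tail e to the node head e; rt j i is the
   fraction of the flow leaving j that enters i. *)
Definition downstream : rel E := [rel j i | head j == tail i].

Definition row_sum (j : E) : R := \sum_i rt j i.

Definition routing_matrix : Prop :=
  forall j i, ~~ downstream j i -> rt j i = 0.

Definition substochastic : Prop :=
  [/\ forall j i, 0 <= rt j i,
      forall j, row_sum j <= 1
    & exists j, row_sum j < 1].

Definition link_connected : Prop :=
  forall i j, connect downstream i j \/ connect downstream j i.

Definition out_connected : Prop :=
  forall i, row_sum i < 1 \/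
    exists2 j, connect [rel k l | 0 < rt k l] i j & row_sum j < 1.

End RoadNetwork.

Section TrafficModel.
Context {R : realType} {E : finType}.
Variables (rt delta : E -> E -> R) (T : R) (lam c : E -> R -> R).

Definition stability_condition : Prop :=
  exists2 eps, 0 < eps &
    forall i, mean T (c i) - \sum_j rt j i * mean T (c j) >
              mean T (lam i) + eps.

Definition instant_upstream (i : E) : pred E :=
  [pred j | (0 < rt j i) && (delta j i == 0)].

Definition delayed_inflow (z : E -> R -> R) (i : E) (t : R) : R :=
  lam i t + \sum_(j | ~~ instant_upstream i j) rt j i * z j (t - delta j i).

Definition lp_feasible (x lt ct : E -> R) (z : E -> R) : Prop :=
  (forall i, z i <= ct i) /\
  (forall i, x i = 0 ->
     z i <= lt i + \sum_(j | instant_upstream i j) rt j i * z j).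

Definition lp_solution (x lt ct : E -> R) (eta : E -> R) (z : E -> R) : Prop :=
  lp_feasible x lt ct z /\
  forall z', lp_feasible x lt ct z' ->
    \sum_i eta i * z' i <= \sum_i eta i * z i.

(* z is one and the same solution for all the weights eta. *)
Definition lp_outflow (x lt ct : E -> R) (z : E -> R) : Prop :=
  forall eta, (forall i, 0 < eta i) -> lp_solution x lt ct eta z.

(* Trajectories are defined on the whole line, as periodic ones are.  Outflows
   are nonnegative: the linear program bounds z only from above, and on the
   whole line there is no initial history from which z >= 0 would propagate. *)
Record trajectory (x z : E -> R -> R) : Prop := {
  trajectory_queue_ge0 : forall i t, 0 <= x i t;
  trajectory_outflow_ge0 : forall i t, 0 <= z i t;
  trajectory_ac : forall i a b, absolutely_continuous a b (x i);
  trajectory_ode : forall i, {ae lebesgue_measure, forall t : R,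
    is_derive t 1 (x i)
      (delayed_inflow z i t
       + \sum_(j | instant_upstream i j) rt j i * z j t - z i t)};
  trajectory_outflow : forall t,
    lp_outflow (x ^~ t) (delayed_inflow z ^~ t) (c ^~ t) (z ^~ t)
}.

Definition periodic_trajectory (x z : E -> R -> R) : Prop :=
  [/\ trajectory x z,
      forall i, periodic (x i) T
    & forall i, periodic (z i) T].

End TrafficModel.

Section SingleLink.
Context {R : realType}.
Variables (T : R) (y c : R -> R).

Definition isolated_outflow (x : R -> R) (t : R) : R :=
  if 0 < x t then c t else Num.min (c t) (y t).

Definition isolated_solution (x0 : R) (x : R -> R) : Prop :=
  [/\ x 0 = x0,
      forall t, 0 <= t <= T -> 0 <= x t,
      absolutely_continuous 0 T x
    & {ae lebesgue_measure, forall t : R, 0 < t < T ->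
         is_derive t 1 x (y t - isolated_outflow x t)}].

Definition maximal_interval (P I : set R) : Prop :=
  [/\ is_interval I,
      exists a b, [/\ I a, I b & a < b],
      I `<=` [set` `[0, T[%R] `&` P
    & forall J : set R, is_interval J -> J `<=` [set` `[0, T[%R] `&` P ->
        I `<=` J -> J `<=` I].

(* The increasing list of the closures, as pairs of end points, of the maximal
   intervals; it exists when P is a finite union of right-open intervals. *)
Definition maximal_intervals (P : set R) : seq (R * R) :=
  xget [::] [set s : seq (R * R) |
    sorted (fun p q => p.1 < q.1) s /\
    forall p, p \in s <->
      exists2 I, maximal_interval P I & closure I = [set` `[p.1, p.2]%R]].

Definition growth_intervals := maximal_intervals [set t | c t < y t].
Definition decay_intervals := maximal_intervals [set t | y t < c t].

(* Indices of intervals are counted from 0. *)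
Definition growth_start (n : nat) : R := (nth (0, 0) growth_intervals n).1.

Definition cum_inflow (s1 s2 : R) : R := integral_over s1 s2 y.
Definition cum_capacity (s1 s2 : R) : R := integral_over s1 s2 c.

(* With r the index r_(j-1), the condition that r_j must be the least n > r
   to satisfy. *)
Definition restart (r n : nat) : bool :=
  has (fun b : R * R =>
         (growth_start n.-1 < b.2 <= growth_start n) &&
         (if b.2 < growth_start n
          then cum_inflow (growth_start r) b.2
                 <= cum_capacity (growth_start r) b.2
          else cum_inflow (growth_start r) b.2
                 < cum_capacity (growth_start r) b.2))
      decay_intervals.

Definition next_restart (r : nat) : option nat :=
  ohead [seq n <- iota r.+1 (size growth_intervals - r.+1) | restart r n].

Fixpoint last_restart (fuel r : nat) : nat :=
  if fuel is fuel'.+1 then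
    if next_restart r is Some n then last_restart fuel' n else r
  else r.

(* The indices r_j increase strictly, so that this fuel is never exhausted. *)
Definition alphaL : R := growth_start (last_restart (size growth_intervals) 0).

Definition initial_queue : R :=
  Num.max (cum_inflow alphaL T - cum_capacity alphaL T) 0.

Definition Fx : R -> R :=
  if lebesgue_measure [set t | 0 <= t < T /\ c t < y t] == 0%E
  then fun=> 0
  else periodic_extension T
         (xget (fun=> 0) [set x | isolated_solution initial_queue x]).

Definition Fz : R -> R := isolated_outflow Fx.

End SingleLink.

Section NetworkAlgorithm.
Context {R : realType} {E : finType}.
Variables (rt delta : E -> E -> R) (T : R) (lam c : E -> R -> R).

(* iter_y k, iter_x k, iter_z k are the iterates of rank k + 1. *)
Fixpoint iter_y (k : nat) : E -> R -> R :=
  if k is k'.+1 then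
    fun i t => lam i t +
      \sum_j rt j i * Fz T (iter_y k' j) (c j) (t - delta j i)
  else lam.

Definition iter_x (k : nat) (i : E) : R -> R := Fx T (iter_y k i) (c i).
Definition iter_z (k : nat) (i : E) : R -> R := Fz T (iter_y k i) (c i).

End NetworkAlgorithm.

(* Main.v *)
Require Import Defs.
From HB Require Import structures.
From mathcomp Require Import all_boot all_order all_algebra.
From mathcomp Require Import all_classical all_reals all_analysis.
From mathcomp Require Import measurable_realfun ring lra zify.
Set Implicit Arguments.
Unset Strict Implicit.
Unset Printing Implicit Defensive.
Import Order.TTheory GRing.Theory Num.Theory.
Import numFieldNormedType.Exports.
Local Open Scope classical_set_scope.
Local Open Scope ring_scope.

(** By optimality for the pointwise linear program, a trajectory obeys on each
    link the law of an isolated link fed with the total inflow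
    ([trajectory_outflowE]).  So the trajectory and all the iterates are
    periodic solutions of the same scalar dynamics, with different inflows.

    That dynamics preserves the order ([link_solution_le]), and a periodic queue
    that is empty at some instant lies below every periodic queue with a larger
    inflow ([periodic_queue_le]).  As outflows increase with inflows and queues,
    the iterates, which start from the external inflows, increase and stay below
    the trajectory ([iter_mono], [iter_le_trajectory]).

    A periodic queue releases over a period what it receives, so the volume by
    which the k-th outflows fall short of those of the trajectory is multiplied
    by the transpose of the routing matrix at each step.  The only nonnegative
    vector with D <= R^T D is 0 ([routing_contraction]), so this gap decreases
    to 0.  By stability every queue of the trajectory is empty at some instant,
    at which the iterated queues are empty as well; hence the distance between
    the queues is at most the gap ([queue_distance]), and the queues converge.
    The outflows then converge at every instant: where the queue of the
    trajectory is positive they are eventually equal to the capacity, and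
    elsewhere their defect is at most the routed and delayed defect of the links
    upstream, to whose supremum over time the same contraction applies
    ([outflow_cvg]).

    This requires that the single-link procedure does produce a periodic queue
    ([Fx_spec]).  With N the cumulative net inflow over [0, t], the periodic
    queue starts from N T - min N; the restarts of the procedure are the
    successive minima of N over the starts of the growth intervals, so that
    alphaL attains the minimum unless T does ([alphaL_min]).  Inflows remain
    step functions along the iteration ([Fz_step]), which makes the lists of
    intervals well defined.  All statements about differential equations rest
    on [ac_nonincreasing]: an absolutely continuous function with nonpositive
    derivative almost everywhere is nonincreasing. *)

(** * Chaining along an interval *)

Section Chaining.
Context {R : realType}.

(** Cousin's lemma: a transitive relation between the end points of intervals
    that holds on both sides of every point, close to it, holds on the whole
    interval.  The supremum of the points chained to a is itself chained to a
    by the left half of its neighbourhood, and is b by the right half. *)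
Lemma interval_chaining (a b : R) (Q : R -> R -> Prop) : a <= b ->
  (forall u, Q u u) ->
  (forall u v w, a <= u -> u <= v -> v <= w -> w <= b ->
     Q u v -> Q v w -> Q u w) ->
  (forall t, a <= t <= b -> exists2 e : R, 0 < e &
     (forall u : R, t - e < u < t -> a <= u -> Q u t) /\
     (forall v : R, t < v < t + e -> v <= b -> Q t v)) ->
  Q a b.
Proof.
move=> ab Qrefl Qtrans Qloc.
pose S := [set t | a <= t <= b /\ Q a t].
have Sa : S a by split; rewrite ?lexx.
have ubS : ubound S b by move=> t [/andP[]].
have supS : has_sup S by split; [exists a | exists b].
pose s := sup S.
have as_ : a <= s by apply: ub_le_sup => //; exists b.
have sb : s <= b by apply: ge_sup => //; exists a.
have [|e e0 [Qleft Qright]] := Qloc s; first by rewrite as_ sb.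
have [t [/andP[at_ tb] Qat] st] := sup_adherent e0 supS.
have ts : t <= s by apply: ub_le_sup => //; [exists b|split => //; apply/andP].
have Qas : Q a s.
  case: (ltgtP t s) ts => // [tlt _|<- //].
  by apply: (Qtrans _ t) => //; [exact: ltW|apply: Qleft; rewrite ?st].
case: (ltgtP s b) sb => // [slt _|<- //].
pose v := Num.min b (s + e / 2).
have sv : s < v by rewrite lt_min slt /= ltrDl divr_gt0.
have vb : v <= b by rewrite ge_min lexx.
have : S v.
  split; first by rewrite vb (le_trans as_) // ltW.
  apply: (Qtrans _ s) => //; first exact: ltW.
  apply: Qright => //; rewrite sv /= (@le_lt_trans _ _ (s + e / 2)) //.
    by rewrite ge_min lexx orbT.
  by rewrite ltrD2l gtr_pMr // invf_lt1 // ltr1n.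
by move=> /(ub_le_sup (ex_intro _ b ubS)); rewrite leNgt sv.
Qed.

End Chaining.

(** * Derivatives *)

Section Derivatives.
Context {R : realType}.
Implicit Types (f g : R -> R) (a b t d : R).

Lemma is_derive_increment t f d : is_derive t 1 f d ->
  forall eps, 0 < eps -> exists2 e : R, 0 < e &
    forall u, `|u - t| < e -> `|f u - f t - d * (u - t)| <= eps * `|u - t|.
Proof.
move=> [/cvg_ex[/= l fl] <-] eps eps0.
have -> : 'D_1 f t = l by apply/cvg_lim.
move/cvgrPdist_le: fl => /(_ _ eps0).
move=> /nbhs_ballP[e /= e0 fe]; exists e => // u ute.
have [->|ut] := eqVneq u t; first by rewrite !subrr mulr0 subr0 normr0 mulr0.
have ut0 : u - t != 0 by rewrite subr_eq0.
have := fe (u - t); rewrite /ball /= sub0r normrN => /(_ ute ut0).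
rewrite -![_ *: _]/(_ * _) mulr1 subrK => h.
have -> : f u - f t - l * (u - t) =
          - ((l - (u - t)^-1 * (f u - f t)) * (u - t)).
  by rewrite mulrBl mulrAC mulVf // mul1r opprB.
by rewrite normrN normrM ler_wpM2r.
Qed.

Lemma is_derive_continuous t f d : is_derive t 1 f d -> {for t, continuous f}.
Proof. by move=> [fd _]; exact/differentiable_continuous/derivable1_diffP. Qed.

Lemma is_derive_eq_open a b t f g d : a < t < b ->
  (forall u, a < u < b -> f u = g u) ->
  is_derive t 1 f d -> is_derive t 1 g d.
Proof.
move=> /andP[at_ tb] fg; apply: near_eq_is_derive; near=> u.
by apply: fg; apply/andP; split; near: u; [apply: lt_nbhsr|apply: lt_nbhsl].
Unshelve. all: by end_near. Qed.

Lemma is_derive_affine t a k t0 : is_derive t 1 (fun u : R => a + k * (u - t0)) k.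
Proof.
apply: is_derive_eq; rewrite ?add0r.
by rewrite subr0 -![_ *: _]/(_ * _) mulr1 mul1r.
Qed.

End Derivatives.

(** * Absolutely continuous functions *)

Section AbsoluteContinuity.
Context {R : realType}.
Implicit Types (f g : R -> R) (a b t d : R).
Notation mu := (@lebesgue_measure R).

(** The first interval and the part of U to the right of it are disjoint, and
    the other intervals lie in the latter. *)
Lemma sum_itv_length_le_measure (s : seq (R * R)) (U : set R) : measurable U ->
  all (fun p => p.1 <= p.2) s -> pairwise (fun p q : R * R => p.2 <= q.1) s ->
  (forall p, p \in s -> [set` `[p.1, p.2]] `<=` U) ->
  ((\sum_(p <- s) (p.2 - p.1))%:E <= mu U)%E.
Proof.
elim: s U => [|p s ih] U mU; first by rewrite big_nil.
rewrite /= big_cons => /andP[p12 alls] /andP[pall pws] sU.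
pose A := [set` `[p.1, p.2[%R] : set R.
pose B := U `&` [set` `[p.2, +oo[%R].
have mB : measurable B by apply: measurableI.
have mA : measurable A by exact: measurable_itv.
have AU : A `<=` U.
  move=> t /=; rewrite /A /= in_itv /= => /andP[t1 t2].
  by apply: (sU p); rewrite ?mem_head //= in_itv /= t1 ltW.
have AB : A `&` B = set0.
  apply/seteqP; split => // t [] /=; rewrite /A /= in_itv /= => /andP[_ t2] [_] /=.
  by rewrite in_itv /= andbT leNgt t2.
apply: (@le_trans _ _ (mu (A `|` B))); last first.
  apply: le_measure; rewrite ?inE //.
    exact: measurableU.
  by rewrite subUset; split => // t [].
rewrite measureU // EFinD; apply: leeD.
  have -> : (p.2 - p.1)%:E = mu A; last exact: lexx.
  rewrite /A lebesgue_measure_itv /= lte_fin -EFinB; case: ltP => // h.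
  by congr EFin; apply/eqP; rewrite subr_eq0 eq_le h p12.
apply: ih => // q qs t tq; split; first by apply: (sU q); rewrite // in_cons qs orbT.
rewrite /= in_itv /= andbT; move: tq; rewrite /= in_itv /= => /andP[q1 _].
by apply: le_trans q1; move/allP: pall; apply.
Qed.

Lemma ae_mono (P Q : set R) : nbhs (almost_everywhere mu) P -> P `<=` Q ->
  nbhs (almost_everywhere mu) Q.
Proof. by move=> aeP PQ; apply: negligibleS aeP; apply: subsetC. Qed.

Lemma ae_and (P Q : set R) : nbhs (almost_everywhere mu) P ->
  nbhs (almost_everywhere mu) Q -> nbhs (almost_everywhere mu) (P `&` Q).
Proof. by move=> aeP aeQ; rewrite /nbhs /= /almost_everywhere setCI; exact: negligibleU. Qed.

Lemma negligible_set1 (t : R) : mu.-negligible [set t].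
Proof. by exists [set t]; split => //; rewrite lebesgue_measure_set1. Qed.

Lemma ae_off_finite (A P : set R) : finite_set A ->
  (forall u, ~ A u -> P u) -> nbhs (almost_everywhere mu) P.
Proof.
move=> fA AP; apply: (@negligibleS _ _ _ mu A) => [u /= nP|].
  by apply: contrapT => /AP.
have cA := finite_set_countable fA.
exists A; split => //; first exact: countable_measurable.
exact: countable_lebesgue_measure0.
Qed.

Lemma negligible_outer_open (N : set R) (d : R) : mu.-negligible N -> 0 < d ->
  exists U : set R, [/\ open U, N `<=` U & (mu U < d%:E)%E].
Proof.
move=> [M [mM M0 NM]] d0.
have [|U [oU MU UM]] := @lebesgue_regularity_outer _ M d mM _ d0.
  exact: (eq_ind_r (fun x => (x < +oo)%E) (ltry 0) M0).
exists U; split => //; first exact: subset_trans NM MU.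
have mU : measurable U by apply: open_measurable.
apply: le_lt_trans UM.
have UE : U = (U `\` M) `|` M.
  apply/seteqP; split => [x Ux|x [[]|/MU]//].
  by have [Mx|nMx] := pselect (M x); [right|left].
rewrite [X in (mu X <= _)%E]UE.
rewrite measureU //; last 2 first.
- exact: measurableD.
- by rewrite setDE -setIA setICl setI0.
rewrite [X in (_ + X)%E](_ : _ = 0%E) ?adde0; last exact: M0.
 exact: lexx.
Qed.

Lemma ac_sub a b a' b' f : a <= a' -> b' <= b ->
  absolutely_continuous a b f -> absolutely_continuous a' b' f.
Proof.
move=> aa bb acf e e0; have [d d0 fd] := acf _ e0; exists d => // s alls.
apply: fd; apply: sub_all alls => p /andP[/andP[p1 ->] p2].
by rewrite (le_trans aa p1) (le_trans p2 bb).
Qed.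

Lemma acB a b f g : absolutely_continuous a b f -> absolutely_continuous a b g ->
  absolutely_continuous a b (fun t => f t - g t).
Proof.
move=> acf acg e e0; have e20 : 0 < e / 2 by rewrite divr_gt0.
have [d d0 fd] := acf _ e20; have [d' d'0 gd] := acg _ e20.
exists (Num.min d d') => [|s alls pws]; first by rewrite lt_min d0.
rewrite lt_min => /andP[sd sd'].
rewrite [ltRHS](splitr e); apply: le_lt_trans (ltrD (fd _ alls pws sd) (gd _ alls pws sd')).
rewrite -big_split /=; apply: ler_sum => p _.
by rewrite (_ : _ - _ = f p.2 - f p.1 - (g p.2 - g p.1)) ?ler_normB //; ring.
Qed.

Lemma lipschitz_ac a b f (K : R) :
  (forall u v, a <= u -> u <= v -> v <= b -> `|f v - f u| <= K * (v - u)) ->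
  absolutely_continuous a b f.
Proof.
move=> lipf e e0; have K0 : 0 < `|K| + 1 by rewrite ltr_wpDl.
exists (e / (`|K| + 1)); first by rewrite divr_gt0.
move=> s alls _; rewrite ltr_pdivlMr // mulrC mulr_sumr; apply: le_lt_trans.
rewrite big_seq [leRHS]big_seq; apply: ler_sum => p /(allP alls) /andP[/andP[p1 p12] p2].
apply: le_trans (lipf _ _ p1 p12 p2) _; rewrite ler_wpM2r ?subr_ge0 //.
by rewrite (le_trans (ler_norm K)) // lerDl.
Qed.

Lemma ac_continuity a b f t : absolutely_continuous a b f -> a <= t <= b ->
  forall e, 0 < e -> exists2 d : R, 0 < d &
    forall u, a <= u <= b -> `|u - t| < d -> `|f u - f t| < e.
Proof.
move=> acf /andP[at_ tb] e e0; have [d d0 fd] := acf _ e0; exists d => // u /andP[au ub] utd.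
have [ut|tu] := leP u t.
  have := fd [:: (u, t)]; rewrite !big_seq1 /= au ut tb => /(_ isT isT).
  by rewrite distrC; apply; rewrite -(ger0_norm (_ : 0 <= t - u)) ?subr_ge0 // distrC.
have := fd [:: (t, u)]; rewrite !big_seq1 /= at_ (ltW tu) ub => /(_ isT isT).
by apply; rewrite -(ger0_norm (_ : 0 <= u - t)) // subr_ge0 ltW.
Qed.

(** The exceptional points are covered by an open set U so small that, by
    absolute continuity, the variation of f over disjoint intervals in U is
    below eps.  Around any other point f grows at a rate of at most eps.  The
    interval [a, b] is chained from steps of both kinds, and the list s records
    the steps inside U. *)
Lemma ac_nonincreasing a b f : a <= b -> absolutely_continuous a b f ->
  {ae mu, forall t : R, a < t < b -> exists2 d, is_derive t 1 f d & d <= 0} ->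
  f b <= f a.
Proof.
move=> ab acf aef; apply/ler_addgt0Pl => e e0.
pose eps := e / (b - a + 1).
have ba0 : 0 < b - a + 1 by rewrite ltr_wpDl // subr_ge0.
have eps0 : 0 < eps by rewrite divr_gt0.
have [d d0 fd] := acf _ eps0.
have [U [oU NU Ud]] := negligible_outer_open
  (negligibleU aef (negligibleU (negligible_set1 a) (negligible_set1 b))) d0.
pose Q u v := exists s : seq (R * R),
  [/\ all (fun p => (u <= p.1) && (p.1 <= p.2) && (p.2 <= v)) s,
      pairwise (fun p q => p.2 <= q.1) s,
      forall p, p \in s -> [set` `[p.1, p.2]] `<=` U
    & f v - f u <= eps * (v - u) + \sum_(p <- s) `|f p.2 - f p.1|].
have [s [alls pws sU fs]] : Q a b.
  apply: interval_chaining => //.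
  - by move=> u; exists [::]; split => //; rewrite big_nil !subrr mulr0 addr0.
  - move=> u v w au uv vw wb [s [alls pws sU fs]] [s' [alls' pws' sU' fs']].
    exists (s ++ s'); split.
    + rewrite all_cat; apply/andP; split.
        by apply: sub_all alls => p /andP[-> /le_trans]; apply.
      apply: sub_all alls' => p /andP[/andP[/(le_trans uv) -> ->] ->] //.
    + rewrite pairwise_cat pws pws' andbT; apply/andP; split => //.
      apply/allrelP => p q /(allP alls)/andP[_ p2] /(allP alls')/andP[/andP[q1 _] _].
      exact: le_trans p2 q1.
    + by move=> p; rewrite mem_cat => /orP[/sU|/sU'].
    + rewrite big_cat /=; apply: le_trans (_ : (f w - f v) + (f v - f u) <= _).
        by rewrite addrA subrK.
      apply: le_trans (lerD fs' fs) _.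
      rewrite le_eqVlt; apply/orP; left; apply/eqP; ring.
  - move=> t /andP[at_ tb].
    have [Ut|nUt] := pselect (U t).
      have [e1 /= e10 eU] : nbhs_ball t U by apply/nbhs_ballP; exact: open_nbhs_nbhs.
      have ballU u v : t - e1 < u -> v < t + e1 -> [set` `[u, v]] `<=` U.
        move=> tu tv w; rewrite /= in_itv /= => /andP[uw wv]; apply: eU.
        by rewrite /ball /= ltr_distlC (lt_le_trans tu) //= (le_lt_trans wv).
      exists e1 => //; split => [u /andP[u1 ut] _|v /andP[tv v1] _].
        exists [:: (u, t)]; rewrite /= big_seq1 /= !lexx (ltW ut); split => //.
          move=> p; rewrite inE => /eqP -> /=; apply: ballU => //.
          by rewrite ltrDl.
        apply: le_trans (ler_norm _) _; rewrite lerDr mulr_ge0 ?(ltW eps0) //.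
        by rewrite subr_ge0 ltW.
      exists [:: (t, v)]; rewrite /= big_seq1 /= !lexx (ltW tv); split => //.
        move=> p; rewrite inE => /eqP -> /=; apply: ballU => //.
        by rewrite ltrBlDr ltrDl.
      apply: le_trans (ler_norm _) _; rewrite lerDr mulr_ge0 ?(ltW eps0) //.
      by rewrite subr_ge0 ltW.
    have tab : a < t < b.
      have ta : t != a by apply/eqP => ta; apply: nUt; apply: NU; right; left.
      have tb' : t != b by apply/eqP => tb'; apply: nUt; apply: NU; right; right.
      by rewrite !lt_neqAle eq_sym ta at_ tb'.
    have [f' ft f'0] : exists2 d, is_derive t 1 f d & d <= 0.
      by apply: contrapT => nf; apply: nUt; apply: NU; left => /(_ tab).
    have [e1 e10 fe1] := is_derive_increment ft eps0.
    exists e1 => //; split => [u /andP[u1 ut] _|v /andP[tv v1] _];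
      exists [::]; rewrite big_nil addr0; split => //.
      have := fe1 u; rewrite distrC ger0_norm ?subr_ge0 ?(ltW ut) //.
      rewrite ltrBlDr -ltrBlDl => /(_ u1); rewrite ler_norml => /andP[+ _].
      rewrite -subr_ge0 => h; rewrite -subr_ge0; apply: le_trans h _.
      rewrite -subr_ge0.
      rewrite (_ : _ - _ = - f' * (t - u)); last by rewrite mulrBr; ring.
      by rewrite mulr_ge0 ?oppr_ge0 // subr_ge0 ltW.
    have := fe1 v; rewrite ger0_norm ?subr_ge0 ?(ltW tv) //.
    rewrite ltrBlDl => /(_ v1); rewrite ler_norml => /andP[_ h].
    have := mulr_ge0 (_ : 0 <= - f') (_ : 0 <= v - t).
    rewrite oppr_ge0 subr_ge0 => /(_ f'0 (ltW tv)); lra.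
have sd : \sum_(p <- s) (p.2 - p.1) < d.
  rewrite -lte_fin; apply: le_lt_trans Ud; apply: sum_itv_length_le_measure => //.
  - exact: open_measurable.
  - by apply: sub_all alls => p /andP[/andP[]].
have := fd s alls pws sd => fs'.
have -> : e + f a = eps * (b - a + 1) + f a by rewrite divfK // gt_eqF.
by rewrite -lerBlDr mulrDr mulr1 (le_trans fs) // lerD2l ltW.
Qed.

End AbsoluteContinuity.

(** * Comparison of queues on an isolated link *)

Section LinkSolutions.
Context {R : realType}.
Implicit Types (x y c : R -> R) (a b t : R).
Notation mu := (@lebesgue_measure R).

(** The part of an isolated solution that makes sense on any interval. *)
Record link_solution y c a b x : Prop := LinkSolution {
  link_ge0 : forall t, a <= t <= b -> 0 <= x t;
  link_ac : absolutely_continuous a b x;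
  link_ode : {ae mu, forall t : R, a < t < b ->
    is_derive t 1 x (y t - isolated_outflow y c x t)}
}.

Lemma isolated_outflow_le y c x t : isolated_outflow y c x t <= c t.
Proof. by rewrite /isolated_outflow; case: ifP => // _; rewrite ge_min lexx. Qed.

Lemma isolated_outflow_ge0 y c x t : 0 <= c t -> 0 <= y t ->
  0 <= isolated_outflow y c x t.
Proof. by move=> c0 y0; rewrite /isolated_outflow; case: ifP; rewrite // le_min c0. Qed.

Lemma isolated_outflow_mono y1 y2 c x1 x2 t : y1 t <= y2 t -> x1 t <= x2 t ->
  isolated_outflow y1 c x1 t <= isolated_outflow y2 c x2 t.
Proof.
rewrite /isolated_outflow => y12 x12; case: ifP => [x10|_].
  by rewrite (lt_le_trans x10 x12).
case: ifP => _; first by rewrite ge_min lexx.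
by rewrite le_min !ge_min lexx y12 orbT.
Qed.

(** With a common queue the outflow is 1-Lipschitz in the inflow: this bounds
    the defect of an outflow by the defect of the inflow. *)
Lemma isolated_outflowB_le y1 y2 c x t : y1 t <= y2 t ->
  isolated_outflow y2 c x t - isolated_outflow y1 c x t <= y2 t - y1 t.
Proof.
rewrite /isolated_outflow => y12; case: ifP => _; first by rewrite subrr subr_ge0.
by case: (leP (c t) (y1 t)); case: (leP (c t) (y2 t)); lra.
Qed.

Lemma link_solution_sub y c a b a' b' x : a <= a' -> b' <= b ->
  link_solution y c a b x -> link_solution y c a' b' x.
Proof.
move=> aa bb [x0 acx odex]; split.
- by move=> t /andP[at_ tb]; apply: x0; rewrite (le_trans aa) // (le_trans tb).
- exact: ac_sub acx.
- apply: (ae_mono odex _) => t h /andP[at_ tb]; apply: h.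
  by rewrite (le_lt_trans aa) // (lt_le_trans tb).
Qed.

(** After the last instant at which x1 <= x2, the queue x1 is positive, hence
    discharges at full capacity, which is at least what x2 discharges; since y1
    is at most y2, the difference x1 - x2 cannot grow from 0. *)
Lemma link_solution_le y1 y2 c a b x1 x2 :
  (forall t, a < t < b -> y1 t <= y2 t) ->
  link_solution y1 c a b x1 -> link_solution y2 c a b x2 -> x1 a <= x2 a ->
  forall t, a <= t <= b -> x1 t <= x2 t.
Proof.
move=> y12 sol1 sol2 x12a t1 /andP[at1 t1b]; rewrite leNgt; apply/negP => x21.
have acg := acB (link_ac sol1) (link_ac sol2).
pose S := [set u | a <= u <= t1 /\ x1 u <= x2 u].
have Sa : S a by split; rewrite ?lexx.
have ubS : has_ubound S by exists t1 => u [/andP[]].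
have supS : has_sup S by split; first by exists a.
pose s := sup S.
have as_ : a <= s by exact: ub_le_sup.
have st1 : s <= t1 by apply: ge_sup => [|u [/andP[]]//]; exists a.
have x12s : x1 s <= x2 s.
  rewrite leNgt; apply/negP => x21s.
  have sab : a <= s <= b by rewrite as_ (le_trans st1).
  have gs0 : 0 < x1 s - x2 s by rewrite subr_gt0.
  have [d d0 gd] := ac_continuity acg sab gs0.
  have [u [/andP[au ut1] x12u] su] := sup_adherent d0 supS.
  have us : u <= s by apply: ub_le_sup => //; split => //; apply/andP.
  have := gd u; rewrite au (le_trans ut1 t1b) => /(_ isT).
  rewrite distrC ger0_norm ?subr_ge0 // ltrBlDr -ltrBlDl => /(_ su).
  rewrite ltr_distl => /andP[+ _]; lra.
have slt : s < t1.
  by rewrite lt_neqAle st1 andbT; apply/eqP => st; move: x12s; rewrite st leNgt x21.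
have x21u u : s < u -> u <= t1 -> x2 u < x1 u.
  move=> su ut1; rewrite ltNge; apply/negP => x12u.
  suff : u <= s by rewrite leNgt su.
  by apply: ub_le_sup => //; split => //; rewrite ut1 (le_trans as_) // ltW.
have := ac_nonincreasing st1 (ac_sub as_ t1b acg) _; rewrite leNgt => /(_ _)/negP; apply.
  apply: (ae_mono (ae_and (link_ode sol1) (link_ode sol2)) _) => u [h1 h2] /andP[su ut1].
  have uab : a < u < b by rewrite (le_lt_trans as_) //= (lt_le_trans ut1).
  exists ((y1 u - isolated_outflow y1 c x1 u) - (y2 u - isolated_outflow y2 c x2 u)).
    by apply: is_deriveB; [exact: h1|exact: h2].
  have := x21u u su (ltW ut1); have := y12 u uab.
  have x2u0 : 0 <= x2 u by apply: (link_ge0 sol2); case/andP: uab => /ltW -> /ltW.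
  have := isolated_outflow_le y2 c x2 u.
  rewrite /isolated_outflow => + + x12u; rewrite (le_lt_trans x2u0 x12u); lra.
by rewrite (@le_lt_trans _ _ 0) ?subr_le0 // subr_gt0.
Qed.

Lemma link_solution_unique y c a b x1 x2 :
  link_solution y c a b x1 -> link_solution y c a b x2 -> x1 a = x2 a ->
  forall t, a <= t <= b -> x1 t = x2 t.
Proof.
move=> s1 s2 e t tab; apply/eqP; rewrite eq_le; apply/andP; split.
  by apply: link_solution_le s1 s2 _ t tab; rewrite ?e.
by apply: link_solution_le s2 s1 _ t tab; rewrite ?e.
Qed.

End LinkSolutions.

(** * Integrals of bounded measurable functions *)

Section BoundedMeasurable.
Context {R : realType}.
Implicit Types (f g : R -> R) (a b t : R).
Notation mu := (@lebesgue_measure R).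

Definition bounded_measurable f :=
  measurable_fun setT f /\ exists K, forall t, `|f t| <= K.

Lemma itv_measure a b : a <= b -> mu [set` `[a, b]] = (b - a)%:E.
Proof.
move=> ab; rewrite lebesgue_measure_itv /= lte_fin -EFinB; case: ltP => // ba.
by congr EFin; apply/esym/eqP; rewrite subr_eq0 eq_le ba.
Qed.

Lemma itv_measure_lty a b : (mu [set` `[a, b]] < +oo)%E.
Proof. by rewrite lebesgue_measure_itv /=; case: ifP; rewrite ?ltry // -EFinB ltry. Qed.

Lemma bounded_measurable_integrable f a b : bounded_measurable f ->
  mu.-integrable [set` `[a, b]] (EFin \o f).
Proof.
move=> [mf [K fK]]; apply: measurable_bounded_integrable => //.
- exact: itv_measure_lty.
- exact: measurable_funTS.
- by exists K; split; [exact: num_real|move=> x Kx t _ /=; rewrite (le_trans (fK t)) // ltW].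
Qed.

Lemma bounded_measurableD f g : bounded_measurable f -> bounded_measurable g ->
  bounded_measurable (fun t => f t + g t).
Proof.
move=> [mf [K fK]] [mg [L gL]]; split; first exact: measurable_funD.
by exists (K + L) => t; rewrite (le_trans (ler_normD _ _)) // lerD.
Qed.

Lemma bounded_measurableZ (k : R) f : bounded_measurable f ->
  bounded_measurable (fun t => k * f t).
Proof.
move=> [mf [K fK]]; split; first by apply: measurable_funM.
by exists (`|k| * K) => t; rewrite normrM ler_wpM2l.
Qed.

Lemma bounded_measurableB f g : bounded_measurable f -> bounded_measurable g ->
  bounded_measurable (fun t => f t - g t).
Proof.
move=> bf bg.
have -> : (fun t => f t - g t) = (fun t => f t + (-1) * g t).
  by apply/funext => t; rewrite mulN1r.
by apply: bounded_measurableD => //; exact: bounded_measurableZ.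
Qed.

Lemma bounded_measurable_cst (k : R) : bounded_measurable (fun=> k).
Proof. by split; [exact: measurable_cst|exists `|k|]. Qed.

Lemma bounded_measurable_sum (I : finType) (P : pred I) (F : I -> R -> R) :
  (forall i, bounded_measurable (F i)) ->
  bounded_measurable (fun t => \sum_(i | P i) F i t).
Proof.
move=> bF; elim: (index_enum I) => [|i s ih].
  rewrite (_ : (fun t => _) = (fun=> 0)); first exact: bounded_measurable_cst.
  by apply/funext => t; rewrite big_nil.
case Pi : (P i).
  rewrite (_ : (fun t => _) = (fun t => F i t + \sum_(j <- s | P j) F j t)).
    exact: bounded_measurableD.
  by apply/funext => t; rewrite big_cons Pi.
rewrite (_ : (fun t => _) = (fun t => \sum_(j <- s | P j) F j t)) //.
by apply/funext => t; rewrite big_cons Pi.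
Qed.

Lemma measurable_shift (d : R) : measurable_fun setT (fun t : R => t - d).
Proof. by apply: measurable_funD => //; exact: measurable_cst. Qed.

Lemma bounded_measurable_shift (d : R) f : bounded_measurable f ->
  bounded_measurable (fun t => f (t - d)).
Proof.
move=> [mf [K fK]]; split; last by exists K.
exact: (measurableT_comp mf (measurable_shift d)).
Qed.

Lemma integral_overD f g a b : bounded_measurable f -> bounded_measurable g ->
  integral_over a b (fun t => f t + g t) = integral_over a b f + integral_over a b g.
Proof. by move=> bf bg; rewrite /integral_over RintegralD //; exact: bounded_measurable_integrable. Qed.

Lemma integral_overB f g a b : bounded_measurable f -> bounded_measurable g ->
  integral_over a b (fun t => f t - g t) = integral_over a b f - integral_over a b g.
Proof. by move=> bf bg; rewrite /integral_over RintegralB //; exact: bounded_measurable_integrable. Qed.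

Lemma integral_overZ (k : R) f a b : bounded_measurable f ->
  integral_over a b (fun t => k * f t) = k * integral_over a b f.
Proof. by move=> bf; rewrite /integral_over RintegralZl //; exact: bounded_measurable_integrable. Qed.

Lemma integral_over_sum (I : finType) (P : pred I) (F : I -> R -> R) a b :
  (forall i, bounded_measurable (F i)) ->
  integral_over a b (fun t => \sum_(i | P i) F i t) =
  \sum_(i | P i) integral_over a b (F i).
Proof.
move=> bF.
have : bounded_measurable (fun t => \sum_(i | P i) F i t) /\
  integral_over a b (fun t => \sum_(i | P i) F i t) =
  \sum_(i | P i) integral_over a b (F i); last by case.
elim: (index_enum I) => [|i s [bs ih]].
  rewrite big_nil (_ : (fun t => _) = (fun=> 0 * 0)).
    rewrite integral_overZ ?mul0r //; last exact: bounded_measurable_cst.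
    by split => //; exact: bounded_measurable_cst.
  by apply/funext => t; rewrite big_nil mulr0.
rewrite big_cons; case Pi : (P i).
  rewrite (_ : (fun t => _) = (fun t => F i t + \sum_(j <- s | P j) F j t)).
    by rewrite integral_overD // ih; split => //; exact: bounded_measurableD.
  by apply/funext => t; rewrite big_cons Pi.
rewrite (_ : (fun t => _) = (fun t => \sum_(j <- s | P j) F j t)) //.
by apply/funext => t; rewrite big_cons Pi.
Qed.

Lemma eq_integral_over f g a b : (forall t, a <= t <= b -> f t = g t) ->
  integral_over a b f = integral_over a b g.
Proof.
by move=> fg; apply: eq_Rintegral => t; rewrite inE /= in_itv /= => /fg.
Qed.

Lemma le_integral_over f g a b : bounded_measurable f -> bounded_measurable g ->
  (forall t, a <= t <= b -> f t <= g t) ->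
  integral_over a b f <= integral_over a b g.
Proof.
move=> bf bg fg; apply: le_Rintegral => //; try exact: bounded_measurable_integrable.
Qed.

Lemma integral_over_split f a b b' : bounded_measurable f -> a <= b -> b <= b' ->
  integral_over a b' f = integral_over a b f + integral_over b b' f.
Proof.
move=> bf ab bb; rewrite {3}/integral_over.
rewrite -(Rintegral_itv_obnd_cbnd (r := b) (b := BRight b') (f := f)); last first.
  apply: integrableS (bounded_measurable_integrable b b' bf) => //.
  by move=> t; rewrite /= !in_itv /= => /andP[/ltW -> ->].
rewrite -(@Rintegral_itvB _ f (BLeft a) (BRight b') b) ?bnd_simp //; last first.
  exact: bounded_measurable_integrable.
by rewrite addrC subrK.
Qed.

Lemma integral_over_cst (k : R) a b : a <= b -> integral_over a b (fun=> k) = k * (b - a).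
Proof.
move=> ab; rewrite /integral_over Rintegral_cst //; congr (_ * _).
exact: (congr1 fine (itv_measure ab)).
Qed.

Lemma integral_over_point f a : integral_over a a f = 0.
Proof. by rewrite /integral_over set_itv1 Rintegral_set1. Qed.

Lemma integral_over_ge0 f a b : (forall t, a <= t <= b -> 0 <= f t) ->
  0 <= integral_over a b f.
Proof. by move=> f0; apply: Rintegral_ge0 => t; rewrite /= in_itv /=; apply: f0. Qed.

(** Lebesgue measure is its own image under a translation, as the two agree on
    bounded intervals. *)
Lemma integral_over_shift f (d a b : R) : bounded_measurable f ->
  integral_over a b (fun t => f (t - d)) = integral_over (a - d) (b - d) f.
Proof.
move=> bf; have [mf _] := bf.
rewrite /integral_over /Rintegral; congr fine.
pose phi := (fun t : R => t - d) : measurableTypeR R -> measurableTypeR R.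
have mphi : measurable_fun setT phi by exact: measurable_shift.
have pre u v : phi @^-1` [set` Interval u v] =
    [set` Interval (match u with BSide c r => BSide c (r + d) | BInfty c => BInfty _ c end)
      (match v with BSide c r => BSide c (r + d) | BInfty c => BInfty _ c end)].
  apply/seteqP; split => t; rewrite /phi /= !itv_boundlr;
  by case: u => [[] u|[]]; case: v => [[] v|[]]; rewrite !bnd_simp ?lerBrDr ?lerBlDr ?ltrBrDr ?ltrBlDr.
transitivity (\int[mu]_(t in phi @^-1` [set` `[(a - d)%R, (b - d)%R]]) ((EFin \o f) \o phi) t)%E.
  by rewrite pre !subrK.
rewrite -integral_pushforward //.
- apply: eq_measure_integral => A mA _.
  apply/esym/lebesgue_measure_unique => // _ [[u v]] _ <-.
  rewrite [RHS](_ : _ = mu (phi @^-1` [set` Interval (BRight u) (BRight v)])) //.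
  rewrite pre /= !lebesgue_measure_itv /=.
  by rewrite !lte_fin ltrD2r -!EFinB opprD addrACA subrr addr0.
- exact/measurable_EFinP.
- rewrite pre !subrK; apply: (bounded_measurable_integrable a b).
  exact: bounded_measurable_shift.
Qed.

Lemma integral_over_lipschitz f (K a : R) : bounded_measurable f ->
  (forall t, `|f t| <= K) -> forall u v, a <= u -> u <= v ->
  `|integral_over a v f - integral_over a u f| <= K * (v - u).
Proof.
move=> bf fK u v au uv; rewrite (integral_over_split bf au uv) addrC addKr.
rewrite -(integral_over_cst K uv).
apply: le_trans (le_normr_Rintegral _ _) _ => //; first exact: bounded_measurable_integrable.
apply: (@le_integral_over (fun t => `|f t|)) => //; last exact: bounded_measurable_cst.
by split; [case: bf => mf _; exact: measurableT_comp|exists K => t; rewrite normr_id].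
Qed.

Lemma integral_over_ac f a b : bounded_measurable f ->
  absolutely_continuous a b (fun t => integral_over a t f).
Proof.
move=> bf; have [_ [K fK]] := bf; apply: (@lipschitz_ac _ _ _ _ K) => u v au uv _.
exact: integral_over_lipschitz.
Qed.

(** The first fundamental theorem is applied to the restriction of f to
    [a, b], which is integrable on the line. *)
Lemma integral_over_is_derive f a b : bounded_measurable f ->
  {ae mu, forall t : R, a < t < b ->
     is_derive t 1 (fun u => integral_over a u f) (f t)}.
Proof.
move=> bf; pose D := [set` `[a, b]] : set R; pose g := f \_ D.
have intg : mu.-integrable setT (EFin \o g).
  have -> : EFin \o g = (EFin \o f) \_ D.
    by apply/funext => t; rewrite /g /= !patchE; case: ifP.
  apply: (integrable_mkcond _ _).1; first exact: measurable_itv.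
  exact: (bounded_measurable_integrable a b bf).
have := @FTC1 R g (BLeft a) _ _.
move=> /(_ _ _)/ae_mono; apply.
- by move=> v; apply: integrableS intg.
- exact: open_integrable_locally openT intg.
- move=> t h /andP[at_ tb].
  have [|gd gE] := h; first by rewrite /= lte_fin.
  apply: (@is_derive_eq_open _ a b t
    (fun u => \int[mu]_(s in [set` Interval (BLeft a) (BRight u)]) g s)%R).
  + by rewrite at_.
  + move=> u /andP[au ub]; apply: eq_integral_over => s /andP[sa su].
    by rewrite /g patchE mem_set // /D /= in_itv /= sa (le_trans su) // ltW.
  + split => //; rewrite -derive1E gE /g patchE mem_set // /D /= in_itv /=.
    by rewrite !ltW.
Qed.

(** The difference between x and the primitive of g is absolutely continuous
    with a derivative that vanishes almost everywhere. *)
Lemma ac_integral (x g : R -> R) a b : a <= b -> bounded_measurable g ->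
  absolutely_continuous a b x ->
  {ae mu, forall t : R, a < t < b -> is_derive t 1 x (g t)} ->
  x b - x a = integral_over a b g.
Proof.
move=> ab bg acx odex.
have acG := @integral_over_ac g a b bg; have dG := @integral_over_is_derive g a b bg.
pose h t := x t - integral_over a t g.
have ha : h a = x a by rewrite /h integral_over_point subr0.
suff : h b = h a by rewrite ha /h => <-; rewrite opprB addrC subrK.
apply/eqP; rewrite eq_le; apply/andP; split.
  apply: ac_nonincreasing => //; first exact: acB.
  apply: (ae_mono (ae_and odex dG) _) => t [h1 h2] tab; exists (g t - g t); last by rewrite subrr.
  by apply: is_deriveB; [exact: h1|exact: h2].
rewrite -lerN2; have := @ac_nonincreasing _ a b (fun t => integral_over a t g - x t) ab (acB acG acx).
rewrite /h !opprB; apply.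
apply: (ae_mono (ae_and odex dG) _) => t [h1 h2] tab; exists (g t - g t); last by rewrite subrr.
by apply: is_deriveB; [exact: h2|exact: h1].
Qed.

Lemma integral_over_nonincreasing (g : R -> R) (s t : R) : bounded_measurable g ->
  0 <= s -> s <= t -> (forall u, s < u < t -> g u <= 0) ->
  integral_over 0 t g <= integral_over 0 s g.
Proof.
move=> bm_g s0 st g0.
apply: (@ac_nonincreasing _ s t (fun u => integral_over 0 u g)) => //.
  by apply: (ac_sub s0 (lexx t)); exact: integral_over_ac.
apply: (ae_mono (integral_over_is_derive 0 t bm_g) _) => u h /andP[su ut].
exists (g u); last by rewrite g0 ?su.
by apply: h; rewrite (le_lt_trans s0).
Qed.

End BoundedMeasurable.

(** * Step functions *)

Section StepFunctions.
Context {R : realType}.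
Notation mu := (@lebesgue_measure R).

(** Piecewise constancy with right-open pieces is recast as a local property:
    unlike the existence of a partition of the period, it passes at once to
    delayed functions, to sums and to comparisons.  Chaining recovers the
    global consequences. *)
Definition right_constant (A : Type) (f : R -> A) (t : R) :=
  exists2 e, 0 < e & forall u, t <= u < t + e -> f u = f t.

Definition left_constant (A : Type) (f : R -> A) (t : R) :=
  exists2 e, 0 < e & exists k, forall u, t - e < u < t -> f u = k.

Definition step_function (A : Type) (f : R -> A) :=
  forall t, right_constant f t /\ left_constant f t.

Lemma step_comp (A B : Type) (h : A -> B) (f : R -> A) :
  step_function f -> step_function (h \o f).
Proof.
move=> sf t; have [[e e0 fe] [d d0 [k fk]]] := sf t; split.
  by exists e => // u /fe /= ->.
by exists d => //; exists (h k) => u /fk /= ->.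
Qed.

Lemma step_pair (A B : Type) (f : R -> A) (g : R -> B) :
  step_function f -> step_function g -> step_function (fun t => (f t, g t)).
Proof.
move=> sf sg t; have [[e e0 fe] [d d0 [k fk]]] := sf t.
have [[e' e'0 ge] [d' d'0 [k' gk]]] := sg t; split.
  exists (Num.min e e'); first by rewrite lt_min e0.
  move=> u /andP[tu]; rewrite -ltrBlDl lt_min !ltrBlDl => /andP[ue ue'].
  by rewrite fe ?ge ?tu.
exists (Num.min d d'); first by rewrite lt_min d0.
exists (k, k') => u /andP[+ ut]; rewrite ltrBlDr -ltrBlDl lt_min !ltrBlDl -!ltrBlDr.
by move=> /andP[ud ud']; rewrite fk ?gk ?ut ?andbT.
Qed.

Lemma step_op2 (A B C : Type) (h : A -> B -> C) (f : R -> A) (g : R -> B) :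
  step_function f -> step_function g -> step_function (fun t => h (f t) (g t)).
Proof. by move=> sf sg; exact: (step_comp (fun p => h p.1 p.2) (step_pair sf sg)). Qed.

Lemma step_sum (I : finType) (P : pred I) (F : I -> R -> R) :
  (forall i, step_function (F i)) -> step_function (fun t => \sum_(i | P i) F i t).
Proof.
move=> sF; elim: (index_enum I) => [|i s ih].
  by move=> t; split; exists 1 => //; [|exists 0] => u _; rewrite !big_nil.
case Pi : (P i).
  rewrite (_ : (fun t => _) = (fun t => F i t + \sum_(j <- s | P j) F j t)).
    exact: (step_op2 +%R).
  by apply/funext => t; rewrite big_cons Pi.
rewrite (_ : (fun t => _) = (fun t => \sum_(j <- s | P j) F j t)) //.
by apply/funext => t; rewrite big_cons Pi.
Qed.

Lemma step_shift (A : Type) (f : R -> A) (d : R) : step_function f ->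
  step_function (fun t => f (t - d)).
Proof.
move=> sf t; have [[e e0 fe] [e' e'0 [k fk]]] := sf (t - d); split.
  by exists e => // u /andP[u1 u2]; rewrite fe // lerD2r u1 /= addrAC ltrD2r.
by exists e' => //; exists k => u /andP[u1 u2]; rewrite fk // ltrD2r u2 andbT addrAC ltrD2r.
Qed.

Lemma step_measurable_itv (f : R -> R) (a b : R) : step_function f ->
  a <= b -> measurable_fun [set` `[a, b]] f.
Proof.
move=> sf ab; apply: (@interval_chaining R a b (fun u v => measurable_fun [set` `[u, v]] f)) => //.
- by move=> u; rewrite set_itv1; exact: measurable_fun_set1.
- move=> u v w au uv vw wb m1 m2.
  have -> : [set` `[u, w]] = [set` `[u, v]] `|` [set` `[v, w]] :> set R.
    apply/seteqP; split => [t|t []] /=; rewrite !in_itv /=.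
    + by move=> /andP[ut tw]; case: (leP t v) => tv; [left|right]; rewrite ?ut ?tv ?tw ?(ltW tv).
    + by move=> /andP[-> /le_trans ->].
    + by move=> /andP[/(le_trans uv) -> ->].
  by apply/measurable_funU => //; split.
- move=> t _; have [[e e0 fe] [d d0 [k fk]]] := sf t.
  exists (Num.min d e); first by rewrite lt_min d0.
  split=> [u /andP[u1 ut] _|v /andP[tv v1] _].
    have -> : [set` `[u, t]] = [set` `[u, t[] `|` [set t] :> set R.
      apply/seteqP; split => [s|s []] /=; rewrite !in_itv /=.
      + by move=> /andP[us]; rewrite le_eqVlt => /predU1P[->|st]; [right|left; rewrite us].
      + by move=> /andP[-> /ltW].
      + by move=> ->; rewrite lexx ltW.
    apply/measurable_funU => //; split; last exact: measurable_fun_set1.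
    apply: (eq_measurable_fun (fun=> k)); last exact: measurable_cst.
    move=> s; rewrite inE /= in_itv /= => /andP[us st]; rewrite fk // st andbT.
    apply: lt_le_trans us; apply: le_lt_trans u1; rewrite lerD2l lerN2 ge_min.
    by rewrite lexx.
  apply: (eq_measurable_fun (fun=> f t)); last exact: measurable_cst.
  move=> s; rewrite inE /= in_itv /= => /andP[ts sv]; rewrite fe // ts /=.
  by apply: le_lt_trans sv _; apply: lt_le_trans v1 _; rewrite lerD2l ge_min lexx orbT.
Qed.

Lemma step_measurable (f : R -> R) : step_function f -> measurable_fun setT f.
Proof.
move=> sf; have -> : setT = \bigcup_n ([set` `[- n%:R, n%:R]] : set R).
  apply/seteqP; split => // t _; exists (Num.bound `|t|) => //=.
  by rewrite in_itv /= -ler_norml ltW // archi_boundP.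
apply/measurable_fun_bigcup => // n; apply: step_measurable_itv => //.
by rewrite (@le_trans _ _ 0) // oppr_le0.
Qed.

Lemma step_bounded_itv (f : R -> R) (a b : R) : step_function f -> a <= b ->
  exists K, forall t, a <= t <= b -> `|f t| <= K.
Proof.
move=> sf ab; apply: (@interval_chaining R a b
  (fun u v => exists K, forall t, u <= t <= v -> `|f t| <= K)) => //.
- by move=> u; exists `|f u| => t /le_anti ->.
- move=> u v w au uv vw wb [K fK] [L fL]; exists (Num.max K L) => t /andP[ut tw].
  rewrite le_max; case: (leP t v) => tv; first by rewrite fK ?ut.
  by rewrite fL ?orbT // tw ltW.
- move=> t _; have [[e e0 fe] [d d0 [k fk]]] := sf t.
  exists (Num.min d e); first by rewrite lt_min d0.
  split=> [u /andP[u1 ut] _|v /andP[tv v1] _].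
    exists (Num.max `|k| `|f t|) => s /andP[us]; rewrite le_eqVlt => /predU1P[->|st].
      by rewrite le_max lexx orbT.
    rewrite fk ?le_max ?lexx // st andbT.
    apply: lt_le_trans us; apply: le_lt_trans u1; rewrite lerD2l lerN2 ge_min.
    by rewrite lexx.
  exists `|f t| => s /andP[ts sv]; rewrite fe // ts /=.
  by apply: le_lt_trans sv _; apply: lt_le_trans v1 _; rewrite lerD2l ge_min lexx orbT.
Qed.

End StepFunctions.

(** * Periodic functions *)

Section Periodic.
Context {R : realType}.
Variables (T : R).
Hypothesis T_gt0 : 0 < T.

(** The representative in [0, T) of an instant modulo the period. *)
Definition phase (t : R) : R := t - T * (Num.floor (t / T))%:~R.

Lemma phase_itv t : 0 <= phase t < T.
Proof.
rewrite /phase; have := floor_itv (t / T); rewrite ler_pdivlMr // ltr_pdivrMr //.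
rewrite subr_ge0 mulrC => /andP[-> /=]; rewrite intrD mulrDl mul1r mulrC => h.
by rewrite ltrBlDl.
Qed.

Lemma periodic_int (A : Type) (f : R -> A) (n : int) t : (forall u, f (u + T) = f u) ->
  f (t + T * n%:~R) = f t.
Proof.
move=> pf; have pn (m : nat) u : f (u + T * m%:R) = f u.
  elim: m => [|m ih]; first by rewrite mulr0 addr0.
  by rewrite -natr1 mulrDr mulr1 addrA pf.
case: n => n; first exact: pn.
by rewrite NegzE mulrNz mulrN -{2}(subrK (T * n.+1%:R) t) pn.
Qed.

Lemma periodic_phase (f : R -> R) t : periodic f T -> f (phase t) = f t.
Proof. by move=> pf; rewrite /phase -mulrN -mulrNz periodic_int. Qed.

Lemma phase_id t : 0 <= t < T -> phase t = t.
Proof.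
move=> /andP[t0 tT]; rewrite /phase (_ : Num.floor (t / T) = 0) ?mulr0 ?subr0 //.
by apply: Num.Theory.floor_def; rewrite divr_ge0 ?(ltW T_gt0) //= add0r ltr_pdivrMr // mul1r.
Qed.

Lemma phaseD t : phase (t + T) = phase t.
Proof.
rewrite /phase mulrDl divff ?gt_eqF // floorDrz ?rpred1 // floor1 intrD mulrDr mulr1.
by rewrite opprD addrACA subrr addr0.
Qed.

Lemma periodic_extension_periodic (f : R -> R) : periodic (periodic_extension T f) T.
Proof. by move=> t; rewrite /periodic_extension -/(phase _) phaseD. Qed.

Lemma periodic_extension_id (f : R -> R) t : f T = f 0 -> 0 <= t <= T ->
  periodic_extension T f t = f t.
Proof.
move=> fT /andP[t0]; rewrite le_eqVlt => /predU1P[->|tT].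
  have := periodic_extension_periodic f 0; rewrite add0r => ->.
  by rewrite /periodic_extension -/(phase _) phase_id ?fT // lexx.
by rewrite /periodic_extension -/(phase _) phase_id ?t0.
Qed.

(** The left germ at a multiple of the period is the left germ at T, whence
    the interval ]0, T] in the second premise. *)
Lemma step_of_period (f : R -> R) : periodic f T ->
  (forall t, 0 <= t < T -> right_constant f t) ->
  (forall t, 0 < t <= T -> left_constant f t) -> step_function f.
Proof.
move=> pf fr fl t; pose n := Num.floor (t / T).
have shift u : f (u - T * n%:~R) = f u by rewrite -mulrN -mulrNz periodic_int.
split.
  have [e e0 fe] := fr _ (phase_itv t); exists e => // u /andP[tu ue].
  rewrite -shift -[RHS]shift; apply: fe; rewrite /phase -/n lerD2r tu /=.
  by rewrite addrAC ltrD2r.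
have [phase0|phase0] := eqVneq (phase t) 0.
  have [|e e0 [k fk]] := fl T; first by rewrite T_gt0 lexx.
  exists e => //; exists k => u /andP[tu ut].
  rewrite -shift -pf; apply: fk; move/eqP : phase0; rewrite subr_eq0 -/n => /eqP tE.
  by rewrite tE in tu ut; apply/andP; split; lra.
have [|e e0 [k fk]] := fl (phase t).
  by have /andP[p0 pT] := phase_itv t; rewrite lt_neqAle eq_sym phase0 p0 ltW.
exists e => //; exists k => u /andP[tu ut].
by rewrite -shift; apply: fk; rewrite /phase -/n addrAC !ltrD2r tu.
Qed.

Lemma piecewise_constant_step (f : R -> R) : periodic f T ->
  piecewise_constant T f -> step_function f.
Proof.
move=> pf [s part_s fs].
suff gen a : itv_partition a T s ->
    (forall k t, (k < size s)%N -> nth 0 (a :: s) k <= t < nth 0 (a :: s) k.+1 ->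
       f t = f (nth 0 (a :: s) k)) ->
    (forall t, a <= t < T -> right_constant f t) /\
    (forall t, a < t <= T -> left_constant f t).
  by have [fr fl] := gen 0 part_s fs; exact: step_of_period.
move=> {part_s fs}; elim: s a => [|x s ih] a.
  move=> /itv_partition_nil -> _.
  split => t /andP[t1 t2].
    by have := le_lt_trans t1 t2; rewrite ltxx.
  by have := lt_le_trans t1 t2; rewrite ltxx.
move=> [/= /andP[ax pxs] lxs] fs.
have [|fr fl] := ih x (conj pxs lxs).
  by move=> k t ks; apply: (fs k.+1 t).
have f0 t : a <= t < x -> f t = f a by apply: (fs 0%N).
split => t /andP[t1 t2].
  have [xt|tx] := leP x t; first by apply: fr; rewrite xt.
  exists (x - t); first by rewrite subr_gt0.
  move=> u; rewrite addrC subrK => /andP[tu ux].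
  by rewrite !f0 ?t1 ?tx ?(le_trans t1 tu).
have [xt|tx] := ltP x t; first by apply: fl; rewrite xt.
exists (t - a); first by rewrite subr_gt0.
exists (f a) => u; rewrite opprB addrC subrK => /andP[au ut].
by apply: f0; rewrite (ltW au) (lt_le_trans ut).
Qed.

Lemma step_bounded_measurable (f : R -> R) : periodic f T -> step_function f ->
  bounded_measurable f.
Proof.
move=> pf sf; split; first exact: step_measurable.
have [K fK] := step_bounded_itv sf (ltW T_gt0); exists K => t.
rewrite -(periodic_phase t pf); apply: fK.
by have /andP[-> /ltW] := phase_itv t.
Qed.

Lemma integral_over_period (f : R -> R) a : periodic f T -> bounded_measurable f ->
  integral_over a (a + T) f = integral_over 0 T f.
Proof.
move=> pf bf.
have -> : integral_over a (a + T) f = integral_over (phase a) (phase a + T) f.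
  rewrite /phase addrAC -integral_over_shift //; apply: eq_integral_over => t _.
  by rewrite -mulrN -mulrNz periodic_int.
have /andP[p0 pT] := phase_itv a.
rewrite (@integral_over_split _ _ (phase a) T) //; last 2 first.
- exact: ltW.
- by rewrite lerDr.
have -> : integral_over T (phase a + T) f = integral_over 0 (phase a) f.
  rewrite -[in RHS](subrr T) -[in RHS](addrK T (phase a)) -integral_over_shift //.
  by apply: eq_integral_over => t _; rewrite -[in LHS](subrK T t) pf.
by rewrite addrC -integral_over_split // ltW.
Qed.

(** Over a period, a delay does not change the volume that a link sends. *)
Lemma integral_over_delay (f : R -> R) (d : R) : periodic f T -> bounded_measurable f ->
  integral_over 0 T (fun t => f (t - d)) = integral_over 0 T f.
Proof.
by move=> pf bf; rewrite integral_over_shift // sub0r addrC integral_over_period.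
Qed.

End Periodic.

(** * Existence of isolated queues *)

Section LinkExistence.
Context {R : realType}.
Implicit Types (x y c : R -> R).
Notation mu := (@lebesgue_measure R).

Lemma link_solution_eq y c (a b : R) x x' : (forall t, a <= t <= b -> x t = x' t) ->
  link_solution y c a b x -> link_solution y c a b x'.
Proof.
move=> xx [x0 acx odex]; split.
- by move=> t tab; rewrite -xx //; exact: x0.
- move=> e e0; have [d d0 xd] := acx e e0; exists d => // s alls pws sd.
  rewrite (_ : \sum_(p <- s) _ = \sum_(p <- s) `|x p.2 - x p.1|); first exact: xd.
  apply: eq_big_seq => p /(allP alls) /andP[/andP[p1 p12] p2].
  by rewrite !xx // ?p1 ?p2 ?andbT ?(le_trans p12) ?(le_trans p1).
- apply: (ae_mono odex _) => t h /andP[at_ tb].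
  rewrite /isolated_outflow -xx ?(ltW at_) ?(ltW tb) //.
  apply: (@is_derive_eq_open _ a b t x); rewrite ?at_ //; last by apply: h; rewrite at_.
  by move=> u /andP[au ub]; rewrite xx // ?ltW.
Qed.

(** Absolute continuity is strengthened to a Lipschitz bound, which is stable
    under concatenation. *)
Definition lipschitz_link_solution y c (K a b : R) x :=
  [/\ forall t, a <= t <= b -> 0 <= x t,
      forall u v, a <= u -> u <= v -> v <= b -> `|x v - x u| <= K * (v - u)
    & {ae mu, forall t : R, a < t < b ->
        is_derive t 1 x (y t - isolated_outflow y c x t)}].

(** With constant rates the queue is affine until it empties, and stays empty
    afterwards.  The law can fail only at the instant at which it empties. *)
Lemma link_solution_constant_rates y c (a b K y0 c0 x0 : R) : a < b -> 0 <= x0 ->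
  (forall t, a < t < b -> y t = y0 /\ c t = c0) -> `|y0 - c0| <= K ->
  lipschitz_link_solution y c K a b (fun t => Num.max (x0 + (y0 - c0) * (t - a)) 0).
Proof.
move=> ab x00 yc yK; pose A t := x0 + (y0 - c0) * (t - a).
have posA t : a < t < b -> 0 < A t ->
    is_derive t 1 (fun t => Num.max (A t) 0) (y0 - c0).
  move=> tab At.
  apply: near_eq_is_derive (is_derive_affine t x0 (y0 - c0) a).
  have : {for t, continuous A} by apply: is_derive_continuous (is_derive_affine t x0 (y0 - c0) a).
  move=> /(@cvgr_gt _ _ _ _ _ (A t)) /(_ 0 At).
  by apply: filterS => u Au; rewrite max_l // ltW.
have negA t : A t < 0 -> is_derive t 1 (fun t => Num.max (A t) 0) (0 : R).
  move=> At; apply: near_eq_is_derive (is_derive_cst (0 : R) t 1).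
  have : {for t, continuous A} by apply: is_derive_continuous (is_derive_affine t x0 (y0 - c0) a).
  move=> /(@cvgr_lt _ _ _ _ _ (A t)) /(_ 0 At).
  by apply: filterS => u Au; rewrite max_r // ltW.
split.
- by move=> t _; rewrite le_max lexx orbT.
- move=> u v au uv vb; rewrite -/(A v) -/(A u).
  have AK : `|A v - A u| <= K * (v - u).
    have -> : A v - A u = (y0 - c0) * (v - u) by rewrite /A; ring.
    by rewrite normrM [`|v - u|]ger0_norm ?subr_ge0 // ler_wpM2r // subr_ge0.
  apply: le_trans AK; case: (leP (A v) 0) => Av; case: (leP (A u) 0) => Au.
  + by rewrite subrr normr0.
  + rewrite sub0r normrN (gtr0_norm Au) distrC ger0_norm; lra.
  + rewrite subr0 (gtr0_norm Av) ger0_norm; lra.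
  + exact: lexx.
- have [yc0|yc0] := ltP y0 c0.
    apply: (@ae_off_finite _ [set a + x0 / (c0 - y0)]) => // t tA tab.
    have [yt ct] := yc t tab; rewrite /isolated_outflow yt ct -/(A t).
    have : A t != 0.
      apply/eqP => At; apply: tA => /=; move: At; rewrite /A => At.
      have -> : x0 = (c0 - y0) * (t - a) by lra.
      by rewrite mulrAC divff ?mul1r ?gt_eqF ?subr_gt0 //; ring.
    rewrite neq_lt => /orP[At|At].
      have := negA t At; rewrite max_r ?ltW // ltxx min_r ?subrr //.
      exact: ltW.
    by have := posA t tab At; rewrite lt_max At.
  apply: (@ae_off_finite _ set0) => // t _ tab.
  have [yt ct] := yc t tab; rewrite /isolated_outflow yt ct -/(A t).
  rewrite (min_l yc0) if_same.
  have [At|At] := ltP 0 (A t); first exact: posA.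
  have ta : 0 < t - a by rewrite subr_gt0; case/andP: tab.
  have ycz : y0 - c0 = 0.
    apply/eqP; rewrite eq_le subr_ge0 yc0 andbT -(pmulr_rle0 _ ta) mulrC.
    by apply: le_trans At; rewrite lerDr.
  rewrite ycz; apply: (@is_derive_eq_open _ a b t (cst (Num.max x0 0))) => //.
  by move=> u _; rewrite mul0r addr0.
Qed.

Lemma lipschitz_link_solution_glue y c (K a b d : R) x x' : a <= b -> b <= d ->
  x b = x' b -> lipschitz_link_solution y c K a b x ->
  lipschitz_link_solution y c K b d x' ->
  lipschitz_link_solution y c K a d (fun t => if t <= b then x t else x' t).
Proof.
move=> ab bd xx [x0 xl xd] [x'0 x'l x'd]; split.
- move=> t /andP[at_ td]; case: (leP t b) => tb; first by apply: x0; rewrite at_.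
  by apply: x'0; rewrite td ltW.
- move=> u v au uv vd; case: (leP u b) => ub; case: (leP v b) => vb.
  + exact: xl.
  + rewrite (_ : x' v - x u = (x' v - x' b) + (x b - x u)); last by rewrite xx addrA subrK.
    apply: le_trans (ler_normD _ _) _.
    have := xl u b au ub (lexx _); have := x'l b v (lexx _) (ltW vb) vd; lra.
  + by have := lt_le_trans ub uv; rewrite ltNge vb.
  + by apply: x'l => //; exact: ltW.
- have off_b : nbhs (almost_everywhere mu) [set t | t != b].
    apply: (@ae_off_finite _ [set b]) => // t /= tb.
    by apply/eqP.
  apply: (ae_mono (ae_and (ae_and xd x'd) off_b) _) => t [[h h'] /= tb] /andP[at_ td].
  rewrite /isolated_outflow; case: (leP t b) => [tleb|bt].
    have {tb tleb} tb : t < b by rewrite lt_neqAle tb.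
    apply: (@is_derive_eq_open _ a b t x); rewrite ?at_ //.
      by move=> u /andP[au ub]; rewrite ltW.
    by apply: h; rewrite at_.
  apply: (@is_derive_eq_open _ b d t x'); rewrite ?bt //.
    by move=> u /andP[bu ud]; rewrite leNgt bu.
  by apply: h'; rewrite bt.
Qed.

(** Solutions from any nonnegative initial queue are chained over short
    intervals on which inflow and capacity are constant.  The common Lipschitz
    constant K is what keeps the concatenations absolutely continuous. *)
Lemma link_solution_exists y c (a b x0 : R) : a <= b -> 0 <= x0 ->
  step_function y -> step_function c ->
  exists2 x, x a = x0 & link_solution y c a b x.
Proof.
move=> ab x00 sy sc.
have syc : step_function (fun t => y t - c t) by exact: (step_op2 (fun u v => u - v)).
have [K ycK] := step_bounded_itv syc ab.
suff /(_ x0 x00) [x xa [x1 x2 x3]] : forall q : R, 0 <= q -> exists2 x, x a = q &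
    lipschitz_link_solution y c K a b x.
  by exists x => //; split => //; exact: lipschitz_ac x2.
apply: (@interval_chaining R a b (fun u v => forall q : R, 0 <= q ->
  exists2 x, x u = q & lipschitz_link_solution y c K u v x)) => //.
- move=> u x1 x10; exists (fun=> x1) => //; split => //.
  + by move=> s v us sv vu; rewrite subrr normr0 (_ : v = s) ?subrr ?mulr0 //; lra.
  + by apply: aeW => t /andP[/lt_trans ut /ut]; rewrite ltxx.
- move=> u v w au uv vw wb Q1 Q2 x1 x10; have [x xu solx] := Q1 _ x10.
  have [|x' x'v solx'] := Q2 (x v).
    by have [x'0 _ _] := solx; apply: x'0; rewrite uv lexx.
  exists (fun t => if t <= v then x t else x' t); first by rewrite uv.
  exact: lipschitz_link_solution_glue.
- move=> t /andP[at_ tb].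
  have [[e e0 fe] [d d0 [[ky kc] fk]]] := step_pair sy sc t.
  exists (Num.min d e); first by rewrite lt_min d0.
  split=> [u /andP[u1 ut] au|v /andP[tv v1] vb] x1 x10.
    have dut : t - d < u.
      by apply: le_lt_trans u1; rewrite lerD2l lerN2 ge_min lexx.
    have ycu s : u < s < t -> y s = ky /\ c s = kc.
      move=> /andP[us st]; have := fk s; rewrite st (lt_trans dut us) => /(_ isT).
      by move=> [-> ->].
    exists (fun t => Num.max (x1 + (ky - kc) * (t - u)) 0).
      by rewrite subrr mulr0 addr0 max_l.
    apply: link_solution_constant_rates => //.
    have [s1 s2] := midf_lt ut; have [<- <-] := ycu _ (introT andP (conj s1 s2)).
    apply: ycK; rewrite (le_trans au) ?ltW //= ?(lt_le_trans s2) //.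
  have yct s : t <= s < v -> y s = y t /\ c s = c t.
    move=> /andP[ts sv]; have := fe s; rewrite ts (lt_trans sv) //.
      by move=> /(_ isT) [-> ->].
    by apply: lt_le_trans v1 _; rewrite lerD2l ge_min lexx orbT.
  exists (fun s => Num.max (x1 + (y t - c t) * (s - t)) 0).
    by rewrite subrr mulr0 addr0 max_l.
  apply: link_solution_constant_rates => //.
    by move=> s /andP[/ltW ts sv]; apply: yct; rewrite ts.
  by apply: ycK; rewrite at_.
Qed.

Lemma link_solution_0 y c (a b : R) : (forall t, a < t < b -> y t <= c t) ->
  link_solution y c a b (fun=> 0).
Proof.
move=> yc; split => //.
- by apply: (@lipschitz_ac _ _ _ _ 0) => u v _ _ _; rewrite subrr normr0 mul0r.
- apply: aeW => t tab; rewrite /isolated_outflow ltxx min_r ?yc // subrr.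
  exact: is_derive_cst.
Qed.

Lemma link_solution_stays_empty y c (a b : R) x : link_solution y c a b x ->
  x a = 0 -> (forall t, a < t < b -> y t <= c t) -> forall t, a <= t <= b -> x t = 0.
Proof.
move=> solx xa yc; apply: (link_solution_unique solx (link_solution_0 yc)).
by rewrite xa.
Qed.

Lemma isolated_outflow_saturated y c x (t : R) : c t <= y t -> isolated_outflow y c x t = c t.
Proof. by move=> cy; rewrite /isolated_outflow min_l // if_same. Qed.

Lemma isolated_outflow_busy y c x (t : R) : 0 < x t -> isolated_outflow y c x t = c t.
Proof. by rewrite /isolated_outflow => ->. Qed.

Lemma isolated_outflow_free y c x (t : R) : x t = 0 -> y t <= c t ->
  isolated_outflow y c x t = y t.
Proof. by rewrite /isolated_outflow => -> yc; rewrite ltxx min_r. Qed.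

(** Under saturation (c <= y) the outflow is c whatever the queue.  Otherwise a
    positive queue stays positive for a while and an empty one stays empty. *)
Lemma isolated_outflow_right_constant y c (T : R) x (t : R) :
  step_function y -> step_function c -> link_solution y c 0 T x -> 0 <= t < T ->
  right_constant (isolated_outflow y c x) t.
Proof.
move=> sy sc solx /andP[t0 tT]; have [[e e0 yce] _] := step_pair sy sc t.
have ycs s : t <= s < t + e -> y s = y t /\ c s = c t by move=> /yce [-> ->].
have [cy|yc] := leP (c t) (y t).
  exists e => // u ute; have [yu cu] := ycs u ute.
  by rewrite !isolated_outflow_saturated ?yu ?cu.
have xt0 : 0 <= x t by apply: (link_ge0 solx); rewrite t0 ltW.
have [xt|xt] := ltP 0 (x t).
  have [|d d0 xd] := ac_continuity (link_ac solx) (_ : 0 <= t <= T) xt.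
    by rewrite t0 ltW.
  exists (Num.min e (Num.min d (T - t))); first by rewrite !lt_min e0 d0 subr_gt0.
  move=> u /andP[tu]; rewrite -ltrBlDl !lt_min => /and3P[ue ud uT].
  have [|_ cu] := ycs u; first by rewrite tu -ltrBlDl.
  rewrite !isolated_outflow_busy //.
  have := xd u; rewrite (le_trans t0 tu) /= ger0_norm ?subr_ge0 // => /(_ _ ud).
  rewrite ltr_distl => h; have /h/andP[+ _] : u <= T by lra.
  by rewrite subrr.
have {xt0}xt : x t = 0 by apply/eqP; rewrite eq_le xt.
exists (Num.min e (T - t)); first by rewrite lt_min e0 subr_gt0.
move=> u /andP[tu]; rewrite -ltrBlDl lt_min => /andP[ue uT].
have ute : t <= u < t + e by rewrite tu -ltrBlDl.
have [yu cu] := ycs u ute.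
have xu : x u = 0.
  apply: (@link_solution_stays_empty y c t u x) => //; last by rewrite tu lexx.
    by apply: link_solution_sub solx => //; lra.
  move=> s /andP[ts su]; have [|-> ->] := ycs s; last exact: ltW.
  by rewrite (ltW ts) (lt_trans su) // -ltrBlDl.
by rewrite !isolated_outflow_free // ?yu ?cu // ltW.
Qed.

(** As on the right, except that below saturation the queue either is empty at
    some instant just before t, and then remains so, or is positive at all of
    them. *)
Lemma isolated_outflow_left_constant y c (T : R) x (t : R) :
  step_function y -> step_function c -> link_solution y c 0 T x -> 0 < t <= T ->
  left_constant (isolated_outflow y c x) t.
Proof.
move=> sy sc solx /andP[t0 tT]; have [_ [e e0 [[y0 c0] yce]]] := step_pair sy sc t.
have ycs s : t - e < s < t -> y s = y0 /\ c s = c0 by move=> /yce [-> ->].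
have [cy|yc] := leP c0 y0.
  exists e => //; exists c0 => u ute; have [yu cu] := ycs u ute.
  by rewrite !isolated_outflow_saturated ?yu ?cu.
have [[u [/andP[ute ut] u0 xu]]|nou] :=
    pselect (exists u, [/\ t - e < u < t, 0 <= u & x u = 0]).
  exists (t - u); first by rewrite subr_gt0.
  exists y0 => s; rewrite opprB addrC subrK => /andP[us st].
  have [ys cs] := ycs s (introT andP (conj (lt_trans ute us) st)).
  rewrite isolated_outflow_free ?ys ?cs //; last exact: ltW.
  apply: (@link_solution_stays_empty y c u t x) => //; last by rewrite !ltW.
    exact: link_solution_sub solx.
  move=> r /andP[ur rt]; have [|-> ->] := ycs r; last exact: ltW.
  by rewrite rt (lt_trans ute ur).
exists (Num.min e t); first by rewrite lt_min e0.
exists c0 => s /andP[+ st]; rewrite ltrBlDr -ltrBlDl lt_min !ltrBlDl -!ltrBlDr => /andP[es s0].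
rewrite subrr in s0.
have [ys cs] := ycs s (introT andP (conj es st)).
rewrite isolated_outflow_busy // lt_neqAle (link_ge0 solx) ?andbT; last by rewrite !ltW // (lt_le_trans st).
by apply/eqP => xs; apply: nou; exists s; rewrite es st ltW.
Qed.

End LinkExistence.

(** * Maximal intervals *)

Section MaximalIntervals.
Context {R : realType}.
Variables (T : R) (P : set R).
Hypothesis T_gt0 : 0 < T.
Implicit Types (I J : set R).

Let D := [set` `[0, T[%R] `&` P.

Lemma is_intervalU I J : is_interval I -> is_interval J -> I `&` J !=set0 ->
  is_interval (I `|` J).
Proof.
move=> iI iJ [m [Im Jm]] u v + + w /andP[uw wv].
have [wm|mw] := leP w m.
  move=> [Iu|Ju] _; first by left; apply: (iI u m) => //; rewrite uw.
  by right; apply: (iJ u m) => //; rewrite uw.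
move=> _ [Iv|Jv]; first by left; apply: (iI m v) => //; rewrite (ltW mw).
by right; apply: (iJ m v) => //; rewrite (ltW mw).
Qed.

(** The union of I and J is again an interval, so that I, being maximal,
    contains it. *)
Lemma maximal_interval_absorbs I J : maximal_interval T P I -> is_interval J ->
  J `<=` D -> I `&` J !=set0 -> J `<=` I.
Proof.
move=> [iI _ ID maxI] iJ JD IJ.
apply: subset_trans (maxI (I `|` J) _ _ _); first exact: subsetUr.
- exact: is_intervalU.
- by rewrite subUset.
- exact: subsetUl.
Qed.

Lemma maximal_interval_meet_eq I J : maximal_interval T P I ->
  maximal_interval T P J -> I `&` J !=set0 -> I = J.
Proof.
move=> mI mJ IJ; have [iI _ ID _] := mI; have [iJ _ JD _] := mJ.
apply/seteqP; split; last exact: maximal_interval_absorbs IJ.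
by apply: maximal_interval_absorbs mJ _ _ _ => //; rewrite setIC.
Qed.

Lemma closureE I : closure I = [set t | forall e, 0 < e -> exists2 u, I u & `|t - u| < e].
Proof.
apply/seteqP; split => t /= clt.
  move=> e e0; have [u [Iu tu]] := clt _ (nbhsx_ballx t e e0).
  by exists u.
move=> B /nbhs_ballP[e /= e0 eB]; have [u Iu tu] := clt e e0.
by exists u; split => //; exact: eB.
Qed.

Lemma closure_bounds I (p : R * R) : maximal_interval T P I ->
  closure I = [set` `[p.1, p.2]] ->
  [/\ 0 <= p.1, p.1 < p.2, p.2 <= T, forall t, I t -> p.1 <= t <= p.2
    & forall t, p.1 < t < p.2 -> I t].
Proof.
move=> [iI [a [b [Ia Ib ab]]] ID _] clI.
have Ip t : I t -> p.1 <= t <= p.2.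
  by move=> It; have := subset_closure It; rewrite clI /= in_itv.
have p12 : p.1 < p.2.
  have /andP[pa _] := Ip _ Ia; have /andP[_ bp] := Ip _ Ib.
  exact: le_lt_trans pa (lt_le_trans ab bp).
have cl t : p.1 <= t <= p.2 -> forall e, 0 < e -> exists2 u, I u & `|t - u| < e.
  have clIt : p.1 <= t <= p.2 -> closure I t by rewrite clI /= in_itv.
  by move=> /clIt; rewrite closureE.
have p1 : p.1 <= p.1 <= p.2 by rewrite lexx ltW.
have p2 : p.1 <= p.2 <= p.2 by rewrite lexx ltW.
split => //.
- rewrite leNgt; apply/negP => p10.
  have [|u Iu] := cl _ p1 (- p.1); first by rewrite oppr_gt0.
  have [/= + _] := ID _ Iu; rewrite in_itv /= => /andP[u0 _].
  rewrite ltr_distl => /andP[h1 h2]; lra.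
- rewrite leNgt; apply/negP => Tp2.
  have [|u Iu] := cl _ p2 (p.2 - T); first by rewrite subr_gt0.
  have [/= + _] := ID _ Iu; rewrite in_itv /= => /andP[_ uT].
  rewrite ltr_distl => /andP[h1 h2]; lra.
- move=> t /andP[pt tp].
  have [|u Iu] := cl _ p1 (t - p.1); first by rewrite subr_gt0.
  have [|v Iv] := cl _ p2 (p.2 - t); first by rewrite subr_gt0.
  rewrite !ltr_distl => /andP[h1 h2] /andP[h3 h4].
  by apply: (iI u v) => //; apply/andP; split; lra.
Qed.

Lemma maximal_interval_closure I : maximal_interval T P I ->
  closure I = [set` `[inf I, sup I]].
Proof.
move=> [iI [a [b [Ia Ib ab]]] ID _].
have ubI : has_ubound I by exists T => t /ID[/=]; rewrite in_itv /= => /andP[_ /ltW].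
have lbI : has_lbound I by exists 0 => t /ID[/=]; rewrite in_itv /= => /andP[].
have supI : has_sup I by split => //; exists a.
have infI : has_inf I by split => //; exists a.
apply/seteqP; split => t.
  rewrite closureE /= in_itv /= => clt; apply/andP; split; rewrite leNgt; apply/negP => h.
    have [|u Iu] := clt (inf I - t); first by rewrite subr_gt0.
    rewrite ltr_distl => /andP[h1 h2]; have := ge_inf lbI Iu; lra.
  have [|u Iu] := clt (t - sup I); first by rewrite subr_gt0.
  rewrite ltr_distl => /andP[h1 h2]; have := ub_le_sup ubI Iu; lra.
rewrite closureE /= in_itv /= => /andP[it ts] e e0.
have [u Iu ui] := inf_adherent e0 infI.
have [v Iv vs] := sup_adherent e0 supI.
have [tu|ut] := leP t u; first by exists u => //; rewrite ltr_distl; apply/andP; split; lra.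
have [vt|tv] := leP v t; first by exists v => //; rewrite ltr_distl; apply/andP; split; lra.
by exists t; [apply: (iI u v) => //; rewrite !ltW|rewrite subrr normr0].
Qed.

(** The maximal interval is the union of all admissible intervals through t. *)
Lemma maximal_interval_exists J (t : R) : is_interval J -> J `<=` D -> J t ->
  (exists2 u, J u & t < u) -> exists2 I, maximal_interval T P I & J `<=` I.
Proof.
move=> iJ JD Jt [u0 Ju0 tu0].
pose I := [set u | exists K, [/\ is_interval K, K `<=` D, K t & K u]].
have JI : J `<=` I by move=> u Ju; exists J.
exists I => //; split.
- move=> u v [K [iK KD Kt Ku]] [K' [iK' K'D K't K'v]] w /andP[uw wv].
  have [wt|tw] := leP w t.
    by exists K; split => //; apply: (iK u t) => //; rewrite uw.
  by exists K'; split => //; apply: (iK' t v) => //; rewrite (ltW tw).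
- by exists t, u0; split => //; apply: JI.
- by move=> u [K [_ KD _ /KD]].
- move=> K iK KD IK u Ku; exists K; split => //.
  by apply: IK; apply: JI.
Qed.

Hypothesis stepP : forall t, right_constant P t /\ left_constant P t.

Let S := [set p : R * R | exists2 I, maximal_interval T P I & closure I = [set` `[p.1, p.2]]].

(** Both maximal intervals enter J immediately to the right of their left end
    points; as P does not vary on J, each of them absorbs J, so they meet and
    coincide. *)
Lemma maximal_interval_left_inj (p q : R * R) (J : set R) : S p -> S q ->
  is_interval J -> J `<=` [set` `[0, T[] -> (forall u v, J u -> J v -> P u = P v) ->
  (exists2 r, p.1 < r & forall u, p.1 < u < r -> J u) ->
  (exists2 r, q.1 < r & forall u, q.1 < u < r -> J u) -> p = q.
Proof.
move=> [I mI clI] [I' mI' clI'] iJ JT JP.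
have inside (x : R * R) (K : set R) : maximal_interval T P K ->
    closure K = [set` `[x.1, x.2]] ->
    (exists2 r, x.1 < r & forall u, x.1 < u < r -> J u) -> exists2 u, K u & J u.
  move=> mK clK [r xr Jr]; have [_ x12 _ _ Kx] := closure_bounds mK clK.
  have xm : x.1 < Num.min r x.2 by rewrite lt_min xr.
  have [m1] := midf_lt xm; rewrite lt_min => /andP[m2 m3].
  by exists ((x.1 + Num.min r x.2) / 2); [apply: Kx|apply: Jr]; apply/andP.
move=> rp rq; have [u Iu Ju] := inside p I mI clI rp.
have [v I'v Jv] := inside q I' mI' clI' rq.
have JD : J `<=` D.
  move=> w Jw; split; first exact: JT.
  by rewrite (JP w u) //; have [_ _ ID _] := mI; have [] := ID _ Iu.
have JI := maximal_interval_absorbs mI iJ JD (ex_intro _ u (conj Iu Ju)).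
have JI' := maximal_interval_absorbs mI' iJ JD (ex_intro _ v (conj I'v Jv)).
have II' := maximal_interval_meet_eq mI mI' (ex_intro _ u (conj (JI _ Ju) (JI' _ Ju))).
have [_ p12 _ _ _] := closure_bounds mI clI.
have [_ q12 _ _ _] := closure_bounds mI' clI'.
have E : [set` `[p.1, p.2]] = [set` `[q.1, q.2]] :> set R by rewrite -clI II' clI'.
have mem t : (p.1 <= t <= p.2) = (q.1 <= t <= q.2).
  by have := congr1 (fun A : set R => A t) E; rewrite /= !in_itv /= => /is_true_inj.
have := mem p.1; have := mem p.2; have := mem q.1; have := mem q.2.
rewrite !lexx (ltW p12) (ltW q12) /= => /andP[h1 h2] /andP[h3 h4] /esym/andP[h5 h6] /esym/andP[h7 h8].
rewrite (surjective_pairing p) (surjective_pairing q).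
by congr (_, _); apply/eqP; rewrite eq_le ?h1 ?h2 ?h3 ?h4 ?h5 ?h6 ?h7 ?h8.
Qed.

Lemma finite_subsingleton (A : Type) (B : set A) :
  (forall x y, B x -> B y -> x = y) -> finite_set B.
Proof.
move=> Binj; have [[x Bx]|nB] := pselect (B !=set0); last first.
  by rewrite (_ : B = set0) //; apply: contrapT => /eqP/set0P.
have -> : B = [set x] by apply/seteqP; split => [y By|y ->] //=; exact: Binj.
exact: finite_set1.
Qed.

(** On each side of a point, P is constant close to it, and at most one
    maximal interval can start there. *)
Lemma finite_maximal_intervals : finite_set S.
Proof.
suff fin : finite_set [set p | S p /\ 0 <= p.1 < T].
  apply: sub_finite_set fin => p Sp; split => //; have [I mI clI] := Sp.
  have [p0 p12 pT _ _] := closure_bounds mI clI.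
  by rewrite p0 (lt_le_trans p12).
apply: (@interval_chaining R 0 T (fun u v => finite_set [set p | S p /\ u <= p.1 < v])).
- exact: ltW.
- move=> u; rewrite (_ : [set p | _] = set0); first exact: finite_set0.
  by apply/seteqP; split => // p [_ /andP[/le_lt_trans h /h]]; rewrite ltxx.
- move=> u v w _ uv vw _ f1 f2.
  apply: (@sub_finite_set _ _ ([set p | S p /\ u <= p.1 < v] `|` [set p | S p /\ v <= p.1 < w])).
    move=> p [Sp /andP[up pw]]; have [pv|vp] := ltP p.1 v; first by left; split; rewrite ?up.
    by right; split; rewrite ?vp.
  by rewrite finite_setU.
- move=> t /andP[t0 tT]; have [[e e0 Pe] [d d0 [k Pk]]] := stepP t.
  have ltT (p : R * R) : S p -> p.1 < T.
    by move=> [I mI clI]; have [_ p12 pT _ _] := closure_bounds mI clI; exact: lt_le_trans pT.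
  exists (Num.min d e); first by rewrite lt_min d0.
  split=> [u /andP[tu ut] u0|v /andP[tv ve] vT]; apply: finite_subsingleton.
    move=> p q [Sp /andP[up pt]] [Sq /andP[uq qt]].
    have tdu : t - d < u by apply: le_lt_trans tu; rewrite lerD2l lerN2 ge_min lexx.
    apply: (@maximal_interval_left_inj p q [set` `]u, t[]) => //.
    + exact: interval_is_interval.
    + by move=> s; rewrite /= !in_itv /= => /andP[us st]; rewrite (le_trans u0 (ltW us)) (lt_le_trans st).
    + move=> s s'; rewrite /= !in_itv /= => /andP[us st] /andP[us' st'].
      by rewrite !Pk ?st ?st' ?(lt_trans tdu).
    + by exists t => // s /andP[ps st]; rewrite /= in_itv /= st (le_lt_trans up).
    + by exists t => // s /andP[ps st]; rewrite /= in_itv /= st (le_lt_trans uq).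
  move=> p q [Sp /andP[tp pv]] [Sq /andP[tq qv]].
  have vte : v < t + e by apply: lt_le_trans ve _; rewrite lerD2l ge_min lexx orbT.
  apply: (@maximal_interval_left_inj p q [set` `[t, v[]) => //.
  + exact: interval_is_interval.
  + by move=> s; rewrite /= !in_itv /= => /andP[ts sv]; rewrite (le_trans t0 ts) (lt_le_trans sv).
  + move=> s s'; rewrite /= !in_itv /= => /andP[ts sv] /andP[ts' sv'].
    by rewrite (Pe s) ?(Pe s') ?ts ?ts' ?(lt_trans sv) ?(lt_trans sv').
  + by exists v => // s /andP[ps sv]; rewrite /= in_itv /= sv (le_trans tp) // ltW.
  + by exists v => // s /andP[ps sv]; rewrite /= in_itv /= sv (le_trans tq) // ltW.
Qed.

(** Left end points identify maximal intervals, so that sorting the finite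
    set of their closures by left end points gives a strictly sorted list. *)
Lemma maximal_intervalsP :
  sorted (fun p q => p.1 < q.1) (maximal_intervals T P) /\
  forall p, p \in maximal_intervals T P <-> S p.
Proof.
rewrite /maximal_intervals; case: xgetP => [s _ //|none].
have [s sS] := (finite_seqP S).1 finite_maximal_intervals.
exfalso; apply: (none (sort (fun p q : R * R => p.1 <= q.1) (undup s))) => /=; split; last first.
  by move=> p; rewrite mem_sort mem_undup; move: (congr1 (fun A : set (R * R) => A p) sS) => /= <-.
set s' := sort _ _.
have -> : sorted (fun p q : R * R => p.1 < q.1) s' = sorted <%R (map fst s') by rewrite sorted_map.
rewrite lt_sorted_uniq_le; apply/andP; split; last first.
  by rewrite sorted_map sort_sorted // => p q; exact: le_total.
rewrite map_inj_in_uniq ?sort_uniq ?undup_uniq // => p q.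
rewrite !mem_sort !mem_undup => ps qs pq.
have Sp : S p by rewrite sS.
have Sq : S q by rewrite sS.
have [I mI clI] := Sp; have [I' mI' clI'] := Sq.
have [p0 p12 pT _ Ip] := closure_bounds mI clI.
have [q0 q12 qT _ Iq] := closure_bounds mI' clI'.
apply: (@maximal_interval_left_inj p q [set` `]p.1, Num.min p.2 q.2[]) => //.
- exact: interval_is_interval.
- move=> t; rewrite /= !in_itv /= lt_min => /andP[pt /andP[tp _]].
  by rewrite (le_trans p0 (ltW pt)) (lt_le_trans tp).
- move=> u v; rewrite /= !in_itv /= !lt_min => /andP[pu /andP[up _]] /andP[pv /andP[vp _]].
  have [_ _ ID _] := mI.
  have [_ Pu] := ID u (Ip u (introT andP (conj pu up))).
  have [_ Pv] := ID v (Ip v (introT andP (conj pv vp))).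
  by apply/propext; split.
- exists (Num.min p.2 q.2); first by rewrite lt_min p12 pq.
  by move=> u; rewrite /= in_itv.
- exists (Num.min p.2 q.2); first by rewrite lt_min -pq p12 pq.
  by move=> u; rewrite /= in_itv /= pq.
Qed.

Lemma maximal_intervals_bounds p : p \in maximal_intervals T P ->
  [/\ 0 <= p.1, p.1 < p.2, p.2 <= T & forall t, p.1 < t < p.2 -> P t].
Proof.
move=> /(maximal_intervalsP.2 p).1 [I mI clI].
have [p0 p12 pT _ Ip] := closure_bounds mI clI; split => // t /Ip It.
by have [_ _ ID _] := mI; have [] := ID _ It.
Qed.

Lemma maximal_intervals_cover t : 0 <= t < T -> P t ->
  exists2 p, p \in maximal_intervals T P & [/\ p.1 <= t, t < p.2 & forall u, p.1 < u <= t -> P u].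
Proof.
move=> /andP[t0 tT] Pt; have [[e e0 Pe] _] := stepP t.
pose J := [set` `[t, Num.min T (t + e)[] : set R.
have tm : t < Num.min T (t + e) by rewrite lt_min tT ltrDl.
have [I mI JI] : exists2 I, maximal_interval T P I & J `<=` I.
  apply: (@maximal_interval_exists J t).
  - exact: interval_is_interval.
  - move=> u; rewrite /J /= in_itv /= lt_min => /and3P[tu uT ue]; split.
      by rewrite /= in_itv /= uT (le_trans t0).
    by rewrite Pe // tu.
  - by rewrite /J /= in_itv /= lexx.
  - have [m1 m2] := midf_lt tm; exists ((t + Num.min T (t + e)) / 2) => //.
    by rewrite /J /= in_itv /= ltW.
have clI := maximal_interval_closure mI.
exists (inf I, sup I); first by apply/(maximal_intervalsP.2 _).2; exists I.
have [_ _ _ Ip Ip'] := closure_bounds (p := (inf I, sup I)) mI clI.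
have It : I t by apply: JI; rewrite /J /= in_itv /= lexx.
have [m1 m2] := midf_lt tm.
have Im : I ((t + Num.min T (t + e)) / 2) by apply: JI; rewrite /J /= in_itv /= ltW.
have /andP[/= it _] := Ip _ It; have /andP[_ /= ms] := Ip _ Im.
split => //=; first exact: lt_le_trans ms.
move=> u /andP[iu ut]; have [iI _ ID _] := mI.
have Iu : I u by apply: Ip'; rewrite /= iu; exact: le_lt_trans ut (lt_le_trans m1 ms).
by have [] := ID u Iu.
Qed.

End MaximalIntervals.

(** * Cumulative net inflow and the initial queue *)

Section InitialQueue.
Context {R : realType}.
Variables (T : R) (y c : R -> R).
Hypothesis T_gt0 : 0 < T.
Hypotheses (step_y : step_function y) (step_c : step_function c).
Hypotheses (bm_y : bounded_measurable y) (bm_c : bounded_measurable c).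
Notation mu := (@lebesgue_measure R).

Definition net_inflow (t : R) : R := integral_over 0 t (fun u => y u - c u).

Let N := net_inflow.

Let bm_yc : bounded_measurable (fun u => y u - c u).
Proof. exact: bounded_measurableB. Qed.

Lemma net_inflowB (s t : R) : 0 <= s -> s <= t ->
  cum_inflow y s t - cum_capacity c s t = N t - N s.
Proof.
move=> s0 st; rewrite /N /net_inflow (integral_over_split bm_yc s0 st).
by rewrite /cum_inflow /cum_capacity (integral_overB s t bm_y bm_c); ring.
Qed.

Lemma net_inflow_decay (s t : R) : 0 <= s -> s <= t ->
  (forall u, s < u < t -> y u <= c u) -> N t <= N s.
Proof.
move=> s0 st yc; apply: integral_over_nonincreasing => // u /yc.
by rewrite subr_le0.
Qed.

Lemma net_inflow_growth (s t : R) : 0 <= s -> s <= t ->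
  (forall u, s < u < t -> c u <= y u) -> N s <= N t.
Proof.
move=> s0 st cy; have NE u : N u = - integral_over 0 u (fun u => c u - y u).
  by rewrite /N /net_inflow !integral_overB // opprB.
rewrite !NE lerN2; apply: integral_over_nonincreasing => //.
  exact: bounded_measurableB.
by move=> u /cy; rewrite subr_le0.
Qed.

Lemma step_growth (t : R) :
  right_constant [set u | c u < y u] t /\ left_constant [set u | c u < y u] t.
Proof. exact: (step_comp (fun p : R * R => (p.1 < p.2 : Prop)) (step_pair step_c step_y)). Qed.

Lemma step_decay (t : R) :
  right_constant [set u | y u < c u] t /\ left_constant [set u | y u < c u] t.
Proof. exact: (step_comp (fun p : R * R => (p.1 < p.2 : Prop)) (step_pair step_y step_c)). Qed.

Let gs := growth_intervals T y c.
Let ds := decay_intervals T y c.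
Let w := growth_start T y c.

Lemma exists_last_interval (s : seq (R * R)) (Q : pred (R * R)) p0 : p0 \in s -> Q p0 ->
  exists p, [/\ p \in s, Q p & forall q, q \in s -> Q q -> q.2 <= p.2].
Proof.
elim: s p0 => // p s ih p0; rewrite inE => p0s Qp0.
have [/hasP[q qs Qq]|/hasPn noQ] := boolP (has Q s); last first.
  have ep : p0 = p by move: p0s => /predU1P[//|/noQ]; rewrite Qp0.
  exists p; split; rewrite ?mem_head -?ep // => q; rewrite inE => /predU1P[->|/noQ/negP//].
  by rewrite ep.
have [r [rs Qr rmax]] := ih q qs Qq.
have [/andP[Qp rp]|np] := boolP (Q p && (r.2 <= p.2)).
  exists p; split; rewrite ?mem_head // => x; rewrite inE => /predU1P[->//|xs] Qx.
  exact: le_trans (rmax x xs Qx) rp.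
exists r; split; rewrite ?inE ?rs ?orbT // => x; rewrite inE => /predU1P[->|xs] Qx; last exact: rmax.
by move: np; rewrite Qx /= -ltNge => /ltW.
Qed.

Lemma w_mono m n : (m < n)%N -> (n < size gs)%N -> w m < w n.
Proof.
move=> mn ns; have [sgs _] := maximal_intervalsP T_gt0 step_growth.
have tr : transitive (fun p q : R * R => p.1 < q.1) by move=> ? ? ?; exact: lt_trans.
by apply: (sorted_ltn_nth tr (0, 0) sgs) => //; rewrite inE // (ltn_trans mn ns).
Qed.

Lemma w_le m n : (m <= n)%N -> (n < size gs)%N -> w m <= w n.
Proof. by rewrite leq_eqVlt => /predU1P[->//|mn] ns; apply/ltW/w_mono. Qed.

Lemma w_bounds n : (n < size gs)%N -> 0 <= w n < T /\
  exists2 e, w n < e & forall t, w n < t < e -> c t < y t.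
Proof.
move=> ns; have := @maximal_intervals_bounds _ T _ T_gt0 step_growth _ (mem_nth (0, 0) ns).
move=> [p0 p12 pT pP]; split; first by rewrite p0 (lt_le_trans p12).
by exists (nth (0, 0) gs n).2.
Qed.

(** A decay interval that ends at t lies after the start of growth interval
    n - 1.  A growth interval reaching a point beyond t but starting no later
    than that would contain part of the decay interval. *)
Lemma no_growth_before n t : (n < size gs)%N -> w n.-1 < t -> t <= w n ->
  (exists2 e, e < t & forall u, e < u < t -> y u < c u) ->
  forall u, t < u < w n -> y u <= c u.
Proof.
move=> ns wt tw [e et dec] u /andP[tu uw]; rewrite leNgt; apply/negP => cy.
have [/andP[w0 wT] _] := w_bounds ns.
have [/andP[w'0 _] _] := w_bounds (leq_ltn_trans (leq_pred n) ns).
have [|p pgs [pu up pP]] := @maximal_intervals_cover _ T _ T_gt0 step_growth u _ cy.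
  by rewrite (lt_trans uw wT) andbT (le_trans w'0) // ltW // (lt_trans wt).
pose m := index p gs.
have mgs : (m < size gs)%N by rewrite index_mem.
have wm : w m = p.1 by rewrite /w /growth_start nth_index.
have mn : (m < n)%N.
  by rewrite ltnNge; apply/negP => nm; have := w_le nm mgs; rewrite wm leNgt (le_lt_trans pu uw).
have wmn : w m <= w n.-1 by apply: w_le; [rewrite -ltnS (ltn_predK mn)|exact: leq_ltn_trans (leq_pred n) ns].
have et' : Num.max e (w n.-1) < t by rewrite gt_max et.
have [] := midf_lt et'; set x := _ / 2; rewrite gt_max => /andP[ex wx] xt.
have : c x < y x by apply: pP; rewrite -wm (le_lt_trans wmn) //= ltW // (lt_trans xt).
by rewrite ltNge ltW // dec // ex.
Qed.

(** The queue started empty at w r would be empty at some end b of a decay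
    interval, so that N b <= N (w r), and N does not increase from b to w n. *)
Lemma restart_decreases r n : (r < n)%N -> (n < size gs)%N ->
  restart T y c r n -> N (w n) <= N (w r).
Proof.
move=> rn ns /hasP[b bds /andP[/andP[wb bw] hb]].
have wr : w r <= w n.-1 by apply: w_le; [lia|exact: leq_ltn_trans (leq_pred n) ns].
have [/andP[w0 _] _] := w_bounds (ltn_trans rn ns).
have wrb : w r <= b.2 by rewrite (le_trans wr) // ltW.
have Nb : N b.2 <= N (w r).
  rewrite -subr_le0 -net_inflowB // subr_le0.
  by move: hb; case: ifP => // _ /ltW.
apply: le_trans Nb; apply: net_inflow_decay => //; first exact: le_trans wrb.
have [b0 b12 bT bP] := @maximal_intervals_bounds _ T _ T_gt0 step_decay _ bds.
by apply: no_growth_before wb bw _ => //; exists b.1.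
Qed.

(** If N (w n) < N (w r), then N decreases somewhere between the starts of the
    growth intervals n - 1 and n.  The last decay interval there ends at a
    point where N is at most N (w n), which forces a restart at n. *)
Lemma no_restart_increases r n : (r < n)%N -> (n < size gs)%N ->
  ~~ restart T y c r n -> N (w r) <= N (w n.-1) -> N (w r) <= N (w n).
Proof.
move=> rn ns nrestart wrn; rewrite leNgt; apply/negP => Nn.
have ns' : (n.-1 < size gs)%N by exact: leq_ltn_trans (leq_pred n) ns.
have wr : w r <= w n.-1 by apply: w_le => //; lia.
have [/andP[w0 _] _] := w_bounds (ltn_trans rn ns).
have [/andP[w'0 _] _] := w_bounds ns'.
have [/andP[_ wT] [e we growth]] := w_bounds ns.
have ww : w n.-1 < w n by apply: w_mono => //; lia.
have decay_before t : t < w n -> forall p, p \in ds -> p.1 <= t -> p.2 <= w n.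
  move=> tw p pds pt; rewrite leNgt; apply/negP => wp.
  have [_ _ _ pP] := @maximal_intervals_bounds _ T _ T_gt0 step_decay _ pds.
  have wm : w n < Num.min e p.2 by rewrite lt_min we.
  have [] := midf_lt wm; set x := _ / 2; rewrite lt_min => wx /andP[xe xp].
  have : y x < c x by apply: pP; rewrite xp (le_lt_trans pt) // (lt_trans tw).
  by rewrite ltNge ltW // growth // wx.
have cover t : w n.-1 < t < w n -> y t < c t -> exists p,
    [/\ p \in ds, t < p.2 & w n.-1 < p.2 <= w n].
  move=> /andP[wt tw] yc.
  have [|p pds [pt tp _]] := @maximal_intervals_cover _ T _ T_gt0 step_decay t _ yc.
    by rewrite (le_trans w'0 (ltW wt)) (lt_trans tw).
  exists p; split => //; first by rewrite (lt_trans wt tp) (decay_before t tw).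
have [t wtw yct] : exists2 t, w n.-1 < t < w n & y t < c t.
  apply: contrapT => nodecay.
  suff : N (w n.-1) <= N (w n) by rewrite leNgt (lt_le_trans Nn).
  apply: net_inflow_growth => //; first exact: ltW.
  move=> u wuw; rewrite leNgt; apply/negP => yc; apply: nodecay; by exists u.
have [p0 [p0ds _ Qp0]] := cover t wtw yct.
have [p [pds Qp pmax]] := exists_last_interval
  (Q := fun p : R * R => w n.-1 < p.2 <= w n) p0ds Qp0.
have /andP[wp pw] := Qp.
have p20 : 0 <= p.2 by rewrite (le_trans w'0) // ltW.
have Np : N p.2 < N (w r).
  apply: le_lt_trans Nn; apply: net_inflow_growth => // u /andP[pu uw].
  rewrite leNgt; apply/negP => yc.
  have [|q [qds uq Qq]] := cover u _ yc; first by rewrite uw (lt_trans wp).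
  by have := pmax q qds Qq; rewrite leNgt (lt_trans pu).
move/hasPn: nrestart => /(_ p pds); rewrite wp pw /=.
have : cum_inflow y (w r) p.2 < cum_capacity c (w r) p.2.
  by rewrite -subr_lt0 net_inflowB ?subr_lt0 // (le_trans wr) // ltW.
by move=> lt_p; case: ifP => _; rewrite ?lt_p ?(ltW lt_p).
Qed.

Lemma ohead_filter_iota (p : pred nat) a k :
  if ohead [seq n <- iota a k | p n] is Some n then
    [/\ (a <= n < a + k)%N, p n & forall m, (a <= m < n)%N -> ~~ p m]
  else forall m, (a <= m < a + k)%N -> ~~ p m.
Proof.
elim: k a => [|k ih] a /=; first by move=> m; lia.
have [pa|npa] /= := boolP (p a); first by split => // [|m]; lia.
have := ih a.+1; case: ohead => [n|] h.
  have [h1 h2 h3] := h; split => //; first lia.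
  by move=> m ?; have [->//|?] := eqVneq m a; apply: h3; lia.
by move=> m ?; have [->//|?] := eqVneq m a; apply: h; lia.
Qed.

Lemma no_restart_min r n : (n <= size gs)%N ->
  (forall m, (r < m < n)%N -> ~~ restart T y c r m) ->
  forall m, (r <= m < n)%N -> N (w r) <= N (w m).
Proof.
move=> ns nr; elim=> [|m ih] /andP[rm mn].
  by have -> : r = 0%N by lia.
have [->//|rm'] := eqVneq r m.+1.
apply: no_restart_increases; [lia|lia|apply: nr; lia|apply: ih; lia].
Qed.

(** The restarts are the successive records of the minimum of N over the
    starts of the growth intervals. *)
Lemma last_restart_min fuel r : (r < size gs)%N -> (size gs <= fuel + r)%N ->
  (forall n, (n <= r)%N -> N (w r) <= N (w n)) ->
  (last_restart T y c fuel r < size gs)%N /\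
  forall n, (n < size gs)%N -> N (w (last_restart T y c fuel r)) <= N (w n).
Proof.
elim: fuel r => [|fuel ih] r rs sf rmin; first by lia.
rewrite /= /next_restart -/gs.
have := ohead_filter_iota (restart T y c r) r.+1 (size gs - r.+1).
case: ohead => [n [rn rr nrr]|nr].
  apply: ih; [lia|lia|move=> m mn].
  have Nn : N (w n) <= N (w r) by apply: restart_decreases => //; lia.
  have [mr|rm] := leqP m r; first exact: le_trans Nn (rmin m mr).
  have [->//|mn'] := eqVneq m n.
  apply: le_trans Nn _; apply: (@no_restart_min r n); [lia| |lia].
  by move=> k ?; apply: nrr; lia.
split => // n ns; have [nr'|rn] := leqP n r; first exact: rmin.
apply: (@no_restart_min r (size gs)) => //; last lia.
by move=> k ?; apply: nr; lia.
Qed.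

Lemma alphaL_itv : 0 <= alphaL T y c <= T.
Proof.
rewrite /alphaL -/gs; have [gs0|gs0] := posnP (size gs).
  by rewrite gs0 /= /growth_start nth_default -/gs ?gs0 //= lexx ltW.
have [|ls _] := @last_restart_min (size gs) 0 gs0 (leq_addr _ _).
  by move=> n; rewrite leqn0 => /eqP ->.
by have [/andP[-> /ltW ->] _] := w_bounds ls.
Qed.

(** A minimum of N on [0, T] is attained either at the start of a growth
    interval or at T. *)
Lemma alphaL_min s : 0 <= s <= T -> N (alphaL T y c) <= N s \/ N T <= N s.
Proof.
move=> /andP[s0 sT].
have [[t [/andP[st tT] cy]]|nogrowth] := pselect (exists t, s < t < T /\ c t < y t); last first.
  right; apply: net_inflow_decay => // u su; rewrite leNgt; apply/negP => cy.
  by apply: nogrowth; exists u.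
left; have [|p pgs [pt tp _]] := @maximal_intervals_cover _ T _ T_gt0 step_growth t _ cy.
  by rewrite tT (le_trans s0) // ltW.
have hasgs : has (fun q : R * R => s < q.2) gs.
  by apply/hasP; exists p => //; exact: lt_trans tp.
pose n := find (fun q : R * R => s < q.2) gs.
have ns : (n < size gs)%N by rewrite -has_find.
have sn : s < (nth (0, 0) gs n).2 by exact: (nth_find (0, 0) hasgs).
have gs0 := leq_ltn_trans (leq0n n) ns.
have [|_ wmin] := @last_restart_min (size gs) 0 gs0 (leq_addr _ _).
  by move=> m; rewrite leqn0 => /eqP ->.
apply: le_trans (wmin n ns) _; have [/andP[w0 wT] _] := w_bounds ns.
have [ws|sw] := leP (w n) s.
  apply: net_inflow_growth => // u /andP[wu us]; apply/ltW.
  have [_ _ _ pP] := @maximal_intervals_bounds _ T _ T_gt0 step_growth _ (mem_nth (0, 0) ns).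
  by apply: pP; rewrite wu (lt_trans us).
apply: net_inflow_decay => //; first exact: ltW.
move=> u /andP[su uw]; rewrite leNgt; apply/negP => cyu.
have [|q qgs [qu uq _]] := @maximal_intervals_cover _ T _ T_gt0 step_growth u _ cyu.
  by rewrite (lt_trans uw wT) (le_trans s0) // ltW.
have qs : (index q gs < size gs)%N by rewrite index_mem.
have nq : (n <= index q gs)%N.
  rewrite leqNgt; apply/negP => /(before_find (0, 0)).
  by rewrite nth_index // (lt_trans su uq).
have := w_le nq qs; rewrite {2}/w /growth_start nth_index // leNgt.
by rewrite (le_lt_trans qu uw).
Qed.

End InitialQueue.

(** * The single-link procedure *)

Section SingleLinkProcedure.
Context {R : realType}.
Variables (T : R) (y c : R -> R).
Hypothesis T_gt0 : 0 < T.
Hypotheses (periodic_y : periodic y T) (periodic_c : periodic c T).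
Hypotheses (step_y : step_function y) (step_c : step_function c).
Hypothesis underloaded : integral_over 0 T y < integral_over 0 T c.
Notation mu := (@lebesgue_measure R).

Let bm_y : bounded_measurable y := step_bounded_measurable T_gt0 periodic_y step_y.
Let bm_c : bounded_measurable c := step_bounded_measurable T_gt0 periodic_c step_c.
Let bm_yc : bounded_measurable (fun u => y u - c u) := bounded_measurableB bm_y bm_c.
Let N := net_inflow y c.

Lemma net_inflow_lt0 : N T < 0.
Proof. by rewrite /N /net_inflow integral_overB // subr_lt0. Qed.

Lemma net_inflow_is_derive : {ae mu, forall t : R, 0 < t < T ->
  is_derive t 1 N (y t - c t)}.
Proof. exact: integral_over_is_derive. Qed.

(** The outflow never exceeds the capacity, so a queue grows at least as much
    as the cumulative net inflow N. *)
Lemma link_solution_reflection x (s t : R) : link_solution y c 0 T x ->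
  0 <= s -> s <= t -> t <= T -> N t - N s <= x t - x s.
Proof.
move=> solx s0 st tT.
suff : N t - x t <= N s - x s by lra.
have acN : absolutely_continuous s t N by apply: (ac_sub s0 (lexx t)); exact: integral_over_ac.
apply: (@ac_nonincreasing _ s t (fun u => N u - x u)) => //.
  by apply: acB acN _; apply: ac_sub s0 tT (link_ac solx).
apply: (ae_mono (ae_and net_inflow_is_derive (link_ode solx)) _) => u [h1 h2] /andP[su ut].
have u0T : 0 < u < T by rewrite (le_lt_trans s0) // (lt_le_trans ut).
exists ((y u - c u) - (y u - isolated_outflow y c x u)).
  by apply: is_deriveB; [exact: h1|exact: h2].
have := isolated_outflow_le y c x u; lra.
Qed.

Lemma link_solution_busy x (s t : R) : link_solution y c 0 T x ->
  0 <= s -> s <= t -> t <= T -> (forall u, s < u < t -> 0 < x u) ->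
  x t - x s = N t - N s.
Proof.
move=> solx s0 st tT xpos; apply/eqP; rewrite eq_le link_solution_reflection // andbT.
suff : x t - N t <= x s - N s by lra.
have acN : absolutely_continuous s t N by apply: (ac_sub s0 (lexx t)); exact: integral_over_ac.
apply: (@ac_nonincreasing _ s t (fun u => x u - N u)) => //.
  by apply: acB _ acN; apply: ac_sub s0 tT (link_ac solx).
apply: (ae_mono (ae_and net_inflow_is_derive (link_ode solx)) _) => u [h1 h2] /andP[su ut].
have u0T : 0 < u < T by rewrite (le_lt_trans s0) // (lt_le_trans ut).
exists ((y u - isolated_outflow y c x u) - (y u - c u)).
  by apply: is_deriveB; [exact: h2|exact: h1].
by rewrite isolated_outflow_busy ?subrr // xpos // su.
Qed.

Lemma initial_queueE : initial_queue T y c = Num.max (N T - N (alphaL T y c)) 0.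
Proof.
have /andP[a0 aT] := @alphaL_itv _ T y c T_gt0 step_y step_c bm_y bm_c.
by rewrite /initial_queue net_inflowB.
Qed.

(** The initial queue q is N T - min N.  The reflection inequality from a
    minimiser of N gives x T >= q.  From the last instant s at which the queue
    is empty, x T = N T - N s <= q.  Such an instant exists: otherwise
    x T = q + N T < q, because the link is underloaded. *)
Lemma queue_periodic x : isolated_solution T y c (initial_queue T y c) x ->
  x T = x 0 /\ exists2 t0, 0 <= t0 <= T & x t0 = 0.
Proof.
move=> [x0 xge0 acx odex].
have solx : link_solution y c 0 T x by split.
have T0 := ltW T_gt0.
have qT : initial_queue T y c <= x T.
  rewrite initial_queueE ge_max xge0 ?T0 ?lexx // andbT.
  have /andP[a0 aT] := @alphaL_itv _ T y c T_gt0 step_y step_c bm_y bm_c.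
  have := link_solution_reflection solx a0 aT (lexx T).
  have := xge0 (alphaL T y c); rewrite a0 aT => /(_ isT); lra.
pose Z := [set t | 0 <= t <= T /\ x t = 0].
have [[z Zz]|nZ] := pselect (Z !=set0); last first.
  have xpos u : 0 <= u <= T -> 0 < x u.
    move=> uT; rewrite lt_neqAle xge0 // andbT; apply/eqP => xu.
    by apply: nZ; exists u.
  have xT := link_solution_busy solx (lexx 0) T0 (lexx T) _.
  move: xT; rewrite x0 => xT; exfalso.
  have := net_inflow_lt0; have N0 : N 0 = 0 by exact: integral_over_point.
  have : x T - initial_queue T y c = N T - N 0.
    by apply: xT => u /andP[u0 uT]; apply: xpos; rewrite !ltW.
  by rewrite N0; lra.
have [/andP[z0 zT] xz] := Zz.
split; last by exists z => //; rewrite z0.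
apply/eqP; rewrite eq_le x0 qT andbT.
have ubZ : has_ubound Z by exists T => t [/andP[]].
have supZ : has_sup Z by split => //; exists z.
pose s := sup Z.
have zs : z <= s by exact: ub_le_sup.
have sT : s <= T by apply: ge_sup => [|t [/andP[]]//]; exists z.
have s0 : 0 <= s := le_trans z0 zs.
have xs : x s = 0.
  apply/eqP; rewrite eq_le xge0 ?s0 // andbT leNgt; apply/negP => xs.
  have s0T : 0 <= s <= T by rewrite s0.
  have [d d0 xd] := ac_continuity acx s0T xs.
  have [u Zu su] := sup_adherent d0 supZ; have us : u <= s by exact: ub_le_sup.
  have [uT xu] := Zu.
  have := xd u uT; rewrite distrC ger0_norm ?subr_ge0 // ltrBlDr -ltrBlDl => /(_ su).
  by rewrite xu sub0r normrN gtr0_norm // ltxx.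
have := link_solution_busy solx s0 sT (lexx T); rewrite xs subr0 => ->; last first.
  move=> u /andP[su uT]; have u0T : 0 <= u <= T by rewrite (le_trans s0) ltW.
  rewrite lt_neqAle xge0 // andbT; apply/eqP => xu.
  suff : u <= s by rewrite leNgt su.
  by apply: ub_le_sup => //; split.
rewrite initial_queueE le_max.
have [|h|h] := @alphaL_min _ T y c T_gt0 step_y step_c bm_y bm_c s; first by rewrite s0.
  by apply/orP; left; rewrite lerD2l lerN2.
by apply/orP; right; rewrite subr_le0.
Qed.

Lemma growth_measurable : measurable [set t | 0 <= t < T /\ c t < y t].
Proof.
have -> : [set t | 0 <= t < T /\ c t < y t] =
    [set` `[0, T[] `&` (fun t => c t < y t) @^-1` [set true].
  by apply/seteqP; split => t /=; rewrite in_itv /= => -[-> ->].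
apply: measurable_funTS => //.
by apply: measurable_fun_ltr; exact: step_measurable.
Qed.

Lemma no_growth : mu [set t | 0 <= t < T /\ c t < y t] = 0%E ->
  forall t, 0 <= t < T -> y t <= c t.
Proof.
move=> mu0 t /andP[t0 tT]; rewrite leNgt; apply/negP => cy.
have [[e e0 yce] _] := step_pair step_y step_c t.
have tm : t < Num.min T (t + e) by rewrite lt_min tT ltrDl.
pose A : set R := [set u | 0 <= u < T /\ c u < y u].
pose B : set R := [set` `[t, Num.min T (t + e)[].
have : (mu B <= mu A)%E.
  apply: le_measure; rewrite ?inE; [exact: measurable_itv|exact: growth_measurable|].
  move=> u; rewrite /B /= in_itv /= lt_min => /and3P[tu uT ue].
  have ute : t <= u < t + e by rewrite tu ue.
  have [yu cu] := yce u ute.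
  by split; rewrite ?yu ?cu // uT (le_trans t0).
rewrite [X in (_ <= X)%E]mu0 /B lebesgue_measure_itv /= lte_fin tm -EFinB lee_fin subr_le0.
by rewrite leNgt tm.
Qed.

(** The branch of Fx for inflows that never exceed the capacity is the zero
    queue; the other one is the solution from the initial queue. *)
Lemma Fx_spec : [/\ periodic (Fx T y c) T, link_solution y c 0 T (Fx T y c),
  Fx T y c T = Fx T y c 0 & exists2 t0, 0 <= t0 <= T & Fx T y c t0 = 0].
Proof.
rewrite /Fx; case: ifPn => [/eqP mu0|_].
  split => //; last by exists 0; rewrite ?lexx ?ltW.
  by apply: link_solution_0 => t /andP[t0 tT]; apply: no_growth => //; rewrite tT ltW.
have q0 : 0 <= initial_queue T y c by rewrite /initial_queue le_max lexx orbT.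
case: xgetP => [x _ solx|none]; last first.
  have [x x0 [xge0 acx odex]] := link_solution_exists (ltW T_gt0) q0 step_y step_c.
  by exfalso; apply: (none x).
have [xT [t0 t0T xt0]] := queue_periodic solx.
have ext t : 0 <= t <= T -> periodic_extension T x t = x t.
  exact: periodic_extension_id.
split.
- exact: periodic_extension_periodic.
- apply: (@link_solution_eq _ _ _ _ _ x); last by case: solx.
  by move=> t /ext.
- by rewrite !ext ?lexx ?ltW.
- by exists t0 => //; rewrite ext.
Qed.

Lemma Fz_periodic : periodic (Fz T y c) T.
Proof.
have [px _ _ _] := Fx_spec; move=> t.
by rewrite /Fz /isolated_outflow px periodic_y periodic_c.
Qed.

Lemma Fz_step : step_function (Fz T y c).
Proof.
have [_ solx _ _] := Fx_spec.
apply: (step_of_period T_gt0 Fz_periodic).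
  by move=> t; exact: isolated_outflow_right_constant solx.
by move=> t; exact: isolated_outflow_left_constant solx.
Qed.

End SingleLinkProcedure.

(** * Periodic queues *)

Section PeriodicQueues.
Context {R : realType}.
Variable (T : R).
Hypothesis T_gt0 : 0 < T.

(** At t0 the lower queue is empty, hence the smaller one; comparison carries
    the inequality to T, that is to 0 by periodicity, and from there over the
    whole period. *)
Lemma periodic_queue_le (y1 y2 c x1 x2 : R -> R) (t0 : R) :
  (forall t, y1 t <= y2 t) -> periodic x1 T -> periodic x2 T ->
  link_solution y1 c 0 T x1 -> link_solution y2 c 0 T x2 ->
  0 <= t0 <= T -> x1 t0 = 0 -> forall t, x1 t <= x2 t.
Proof.
move=> y12 p1 p2 sol1 sol2 /andP[t00 t0T] x1t0 t.
rewrite -(periodic_phase t p1) -(periodic_phase t p2).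
have after s : t0 <= s <= T -> x1 s <= x2 s.
  apply: (@link_solution_le _ y1 y2 c t0 T) => //.
  - exact: link_solution_sub sol1.
  - exact: link_solution_sub sol2.
  - by rewrite x1t0; apply: (link_ge0 sol2); rewrite t00.
have := after T; rewrite t0T lexx => /(_ isT).
have [-> ->] : x1 T = x1 0 /\ x2 T = x2 0 by split; rewrite -{1}[T]add0r ?p1 ?p2.
move=> x12.
apply: (link_solution_le _ sol1 sol2 x12) => //.
by have /andP[-> /ltW] := phase_itv T_gt0 t.
Qed.

(** A periodic queue releases over a period exactly what it receives. *)
Lemma periodic_queue_conservation (y c x : R -> R) :
  bounded_measurable y -> bounded_measurable (isolated_outflow y c x) ->
  link_solution y c 0 T x -> x T = x 0 ->
  integral_over 0 T (isolated_outflow y c x) = integral_over 0 T y.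
Proof.
move=> bm_y bm_z solx xT; apply/esym/eqP; rewrite -subr_eq0 -integral_overB //.
rewrite -(ac_integral (ltW T_gt0) (bounded_measurableB bm_y bm_z) (link_ac solx) (link_ode solx)).
by rewrite xT subrr.
Qed.

End PeriodicQueues.

(** * Sub-stochastic routing *)

Section RoutingContraction.
Context {R : realType} {E : finType}.
Variables (rt : E -> E -> R).
Hypotheses (rt_substochastic : substochastic rt) (rt_out : out_connected rt).

Let rt_ge0 j i : 0 <= rt j i.
Proof. by case: rt_substochastic. Qed.

(** Summing D <= R^T D over the links gives the sum of (1 - r_j) D_j <= 0, where
    r_j is the j-th row sum: D vanishes on leaking links, and all the
    inequalities are equalities.  The equality at a link where D vanishes makes
    D vanish at the links that feed it, hence along any path to a leaking
    link. *)
Lemma routing_contraction (D : E -> R) : (forall i, 0 <= D i) ->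
  (forall i, D i <= \sum_j rt j i * D j) -> forall i, D i = 0.
Proof.
move=> D0 DR; have [_ rows _] := rt_substochastic.
have sumD : \sum_i \sum_j rt j i * D j = \sum_j row_sum rt j * D j.
  by rewrite exchange_big; apply: eq_bigr => j _; rewrite -mulr_suml.
have sum_le : \sum_j row_sum rt j * D j <= \sum_j D j.
  by apply: ler_sum => j _; rewrite -[leRHS]mul1r ler_wpM2r.
have sum_ge : \sum_i D i <= \sum_i \sum_j rt j i * D j by apply: ler_sum.
have eq_sum : \sum_i (\sum_j rt j i * D j - D i) = 0.
  by apply/eqP; rewrite eq_le sumrB subr_le0 {1}sumD sum_le subr_ge0.
have eq_row : \sum_j (D j - row_sum rt j * D j) = 0.
  by apply/eqP; rewrite eq_le sumrB subr_le0 -{1}sumD sum_ge subr_ge0.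
have DE i : D i = \sum_j rt j i * D j.
  apply/esym/eqP; rewrite -subr_eq0; apply/eqP.
  by move/psumr_eq0P: eq_sum => -> // k _; rewrite subr_ge0.
have D_leak j : row_sum rt j < 1 -> D j = 0.
  move=> rj; have : D j - row_sum rt j * D j = 0.
    move/psumr_eq0P: eq_row => -> // k _.
    by rewrite subr_ge0 -[leRHS]mul1r ler_wpM2r.
  rewrite -{1}[D j]mul1r -mulrBl => /eqP; rewrite mulf_eq0 => /orP[|/eqP //].
  by rewrite subr_eq0 gt_eqF.
have D_up k l : 0 < rt k l -> D l = 0 -> D k = 0.
  move=> rkl Dl; have : \sum_j rt j l * D j = 0 by rewrite -DE.
  move/psumr_eq0P => /(_ (fun j _ => mulr_ge0 (rt_ge0 j l) (D0 j))) /(_ k isT)/eqP.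
  by rewrite mulf_eq0 gt_eqF // => /eqP.
move=> i; have [/D_leak//|[j /connectP[p + ->]]] := rt_out i.
elim: p i => [|k p ih] i /=; first by move=> _ /D_leak.
by move=> /andP[ik pk] /(ih k pk); exact: D_up.
Qed.

(** The delays disappear on passing to suprema over time. *)
Lemma delayed_routing_contraction (delta : E -> E -> R) (L : E -> R -> R) (K : R) :
  (forall i t, 0 <= L i t <= K) ->
  (forall i t, L i t <= \sum_j rt j i * L j (t - delta j i)) ->
  forall i t, L i t = 0.
Proof.
move=> LK LR; pose D i := sup (range (L i)).
have hasup i : has_sup (range (L i)).
  split; first by exists (L i 0), 0.
  by exists K => _ [t _ <-]; have /andP[] := LK i t.
have LD i t : L i t <= D i by apply: ub_le_sup; [case: (hasup i)|exists t].
have D0 i : 0 <= D i by apply: le_trans (LD i 0); have /andP[] := LK i 0.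
have DR i : D i <= \sum_j rt j i * D j.
  apply: ge_sup; first by case: (hasup i).
  move=> _ [t _ <-]; apply: le_trans (LR i t) _.
  by apply: ler_sum => j _; rewrite ler_wpM2l.
move=> i t; apply/eqP; rewrite eq_le; have /andP[-> _] := LK i t.
by rewrite andbT -(routing_contraction D0 DR i).
Qed.

Lemma routed_sum_cvg (F : nat -> E -> R) (L : E -> R) (i : E) :
  (forall j, F n j @[n --> \oo] --> L j) ->
  \sum_j rt j i * F n j @[n --> \oo] --> \sum_j rt j i * L j.
Proof.
move=> FL; elim: (index_enum E) => [|j s ih].
  rewrite big_nil (_ : (fun n => _) = (fun=> 0)); first exact: cvg_cst.
  by apply/funext => n; rewrite big_nil.
rewrite big_cons (_ : (fun n => _) = (fun n => rt j i * F n j + \sum_(k <- s) rt k i * F n k)).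
  by apply: cvgD => //; exact: cvgMr.
by apply/funext => n; rewrite big_cons.
Qed.

(** The pointwise limit of the defects F satisfies the hypothesis of
    [delayed_routing_contraction]. *)
Lemma delayed_routing_limit (delta : E -> E -> R) (F : nat -> E -> R -> R) (K : R) :
  (forall n i t, 0 <= F n i t <= K) ->
  (forall i t, nonincreasing_seq (fun n => F n i t)) ->
  (forall i t, (exists N, forall n, (N <= n)%N ->
       F n.+1 i t <= \sum_j rt j i * F n j (t - delta j i)) \/
     (exists N, forall n, (N <= n)%N -> F n i t = 0)) ->
  forall i t, F n i t @[n --> \oo] --> (0 : R).
Proof.
move=> FK Fdec FR; pose L i t := limn (fun n => F n i t).
have FL i t : F n i t @[n --> \oo] --> L i t.
  apply: nonincreasing_is_cvgn; first exact: Fdec.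
  by exists 0 => _ [n _ <-]; have /andP[] := FK n i t.
have L0 i t : 0 <= L i t <= K.
  apply/andP; split.
    by apply: limr_ge; [exact: FL|apply: nearW => n; have /andP[] := FK n i t].
  by apply: limr_le; [exact: FL|apply: nearW => n; have /andP[] := FK n i t].
suff Lz : forall i t, L i t = 0 by move=> i t; rewrite -(Lz i t); exact: FL.
apply: (@delayed_routing_contraction delta L K L0) => i t.
have [[N FN]|[N FN]] := FR i t; last first.
  rewrite (_ : L i t = 0).
    by apply: sumr_ge0 => j _; rewrite mulr_ge0 //; case/andP: (L0 j (t - delta j i)).
  apply/cvg_lim => //; apply: cvg_near_cst; near=> n; apply: FN.
  by near: n; exists N.
have cvgR := @routed_sum_cvg (fun n j => F n j (t - delta j i)) _ i (fun j => FL j _).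
have cvgS : F n.+1 i t @[n --> \oo] --> L i t by rewrite (@cvg_shiftS _ (fun n => F n i t)); exact: FL.
apply: ler_cvg_to cvgS cvgR _; near=> n; apply: FN.
by near: n; exists N.
Unshelve. all: by end_near. Qed.

End RoutingContraction.

(** * The linear program *)

Section LinearProgram.
Context {R : realType} {E : finType}.
Variables (rt delta : E -> E -> R).
Hypothesis rt_ge0 : forall j i, 0 <= rt j i.

(** If z i were below its bound, raising it alone up to that bound would keep
    the point feasible, as the routing coefficients are nonnegative, and would
    increase the objective with unit weights. *)
Lemma lp_outflowE (x lt ct z : E -> R) : lp_outflow rt delta x lt ct z ->
  (forall i, 0 <= x i) -> forall i, z i = if 0 < x i then ct i else
    Num.min (ct i) (lt i + \sum_(j | instant_upstream rt delta i j) rt j i * z j).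
Proof.
move=> lpz x0 i; have [[zc zin] zmax] := lpz (fun=> 1) (fun=> ltr01).
set bound := (if _ then _ else _).
have zb : z i <= bound.
  rewrite /bound; case: ifPn => [_|]; first exact: zc.
  rewrite -leNgt => xi; rewrite le_min zc zin //.
  by apply/eqP; rewrite eq_le xi x0.
apply/eqP; rewrite eq_le zb /= leNgt; apply/negP => zlt.
pose z' j := z j + (if j == i then bound - z i else 0).
have zz' j : z j <= z' j by rewrite /z'; case: eqP => _; rewrite ?addr0 // lerDl subr_ge0.
have z'i : z' i = bound by rewrite /z' eqxx addrC subrK.
have z'j j : j != i -> z' j = z j by rewrite /z' => /negPf ->; rewrite addr0.
have sum_le k : \sum_(j | instant_upstream rt delta k j) rt j k * z j <=
    \sum_(j | instant_upstream rt delta k j) rt j k * z' j.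
  by apply: ler_sum => j _; rewrite ler_wpM2l.
have feas : lp_feasible rt delta x lt ct z'.
  split=> k; have [->|ki] := eqVneq k i.
  - by rewrite z'i /bound; case: ifP => // _; rewrite ge_min lexx.
  - by rewrite z'j.
  - move=> xi; rewrite z'i /bound xi ltxx ge_min lerD2l.
    by rewrite (sum_le i) orbT.
  - by move=> xk; rewrite z'j //; apply: le_trans (zin k xk) _; rewrite lerD2l.
have := zmax z' feas; rewrite leNgt => /negP; apply.
under eq_bigr do rewrite mul1r; under [ltRHS]eq_bigr do rewrite mul1r.
rewrite (bigD1 i) //= [ltRHS](bigD1 i) //= z'i.
by apply: ltr_leD => //; apply: ler_sum => j _.
Qed.

End LinearProgram.

(** * Iterates and trajectory of the network *)

Section Network.
Context {R : realType} {E : finType}.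
Variables (rt delta : E -> E -> R) (T : R) (lam c : E -> R -> R).
Hypotheses (rt_substochastic : substochastic rt) (rt_out : out_connected rt).
Hypothesis T_gt0 : 0 < T.
Hypotheses (lam_periodic : forall i, periodic (lam i) T)
  (c_periodic : forall i, periodic (c i) T).
Hypotheses (lam_ge0 : forall i t, 0 <= lam i t) (c_ge0 : forall i t, 0 <= c i t).
Hypotheses (lam_step : forall i, step_function (lam i))
  (c_step : forall i, step_function (c i)).
Hypothesis stable : forall i, integral_over 0 T (lam i) <
  integral_over 0 T (c i) - \sum_j rt j i * integral_over 0 T (c j).
Notation mu := (@lebesgue_measure R).

Let rt_ge0 j i : 0 <= rt j i.
Proof. by case: rt_substochastic. Qed.

Let c_bm i : bounded_measurable (c i) := step_bounded_measurable T_gt0 (c_periodic i) (c_step i).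
Let lam_bm i : bounded_measurable (lam i) :=
  step_bounded_measurable T_gt0 (lam_periodic i) (lam_step i).

Definition total_inflow (z : E -> R -> R) (i : E) (t : R) : R :=
  lam i t + \sum_j rt j i * z j (t - delta j i).

Lemma total_inflow_le (z z' : E -> R -> R) i t : (forall j u, z j u <= z' j u) ->
  total_inflow z i t <= total_inflow z' i t.
Proof. by move=> zz; rewrite lerD2l ler_sum // => j _; rewrite ler_wpM2l. Qed.

Lemma le_total_inflow (z : E -> R -> R) i t : (forall j u, 0 <= z j u) ->
  lam i t <= total_inflow z i t.
Proof. by move=> z0; rewrite lerDl sumr_ge0 // => j _; rewrite mulr_ge0. Qed.

Lemma total_inflow_periodic (z : E -> R -> R) i : (forall j, periodic (z j) T) ->
  periodic (total_inflow z i) T.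
Proof.
move=> pz t; rewrite /total_inflow lam_periodic; congr (_ + _).
by apply: eq_bigr => j _; rewrite addrAC pz.
Qed.

Lemma total_inflow_bm (z : E -> R -> R) i : (forall j, bounded_measurable (z j)) ->
  bounded_measurable (total_inflow z i).
Proof.
move=> bz; apply: bounded_measurableD => //; apply: bounded_measurable_sum => j.
by apply: bounded_measurableZ; exact: bounded_measurable_shift.
Qed.

Lemma total_inflow_step (z : E -> R -> R) i : (forall j, step_function (z j)) ->
  step_function (total_inflow z i).
Proof.
move=> sz; apply: (step_op2 +%R) => //; apply: step_sum => j.
exact: (step_comp (fun u => rt j i * u) (step_shift _ (sz j))).
Qed.

Lemma integral_total_inflow (z : E -> R -> R) i : (forall j, periodic (z j) T) ->
  (forall j, bounded_measurable (z j)) ->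
  integral_over 0 T (total_inflow z i) =
  integral_over 0 T (lam i) + \sum_j rt j i * integral_over 0 T (z j).
Proof.
move=> pz bz; rewrite integral_overD //; last first.
  by apply: bounded_measurable_sum => j; apply: bounded_measurableZ; exact: bounded_measurable_shift.
congr (_ + _); rewrite integral_over_sum; last first.
  by move=> j; apply: bounded_measurableZ; exact: bounded_measurable_shift.
apply: eq_bigr => j _; rewrite integral_overZ; last exact: bounded_measurable_shift.
by rewrite integral_over_delay.
Qed.

Let Y := iter_y rt delta T lam c.
Let X := iter_x rt delta T lam c.
Let Z := iter_z rt delta T lam c.

Lemma iter_yS k i : Y k.+1 i = total_inflow (Z k) i.
Proof. by []. Qed.

Record admissible_inflow (y : E -> R -> R) : Prop := AdmissibleInflow {
  admissible_periodic : forall i, periodic (y i) T;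
  admissible_step : forall i, step_function (y i);
  admissible_ge0 : forall i t, 0 <= y i t;
  admissible_underloaded : forall i, integral_over 0 T (y i) < integral_over 0 T (c i)
}.

Lemma integral_Fz (y : R -> R) i : periodic y T -> step_function y ->
  integral_over 0 T y < integral_over 0 T (c i) ->
  integral_over 0 T (Fz T y (c i)) = integral_over 0 T y.
Proof.
move=> py sy uy; have [px solx xT _] := Fx_spec T_gt0 py (c_periodic i) sy (c_step i) uy.
apply: (periodic_queue_conservation T_gt0 _ _ solx xT).
  exact: (step_bounded_measurable T_gt0).
apply: (step_bounded_measurable T_gt0); [exact: Fz_periodic|exact: Fz_step].
Qed.

(** By conservation the k-th outflow of a link has the integral of its inflow,
    which is below that of the capacity; the stability condition then keeps the
    next inflow below the capacity. *)
Lemma iter_y_admissible k : admissible_inflow (Y k).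
Proof.
elim: k => [|k [py sy y0 uy]].
  split => // i; apply: lt_le_trans (stable i) _; rewrite gerBl sumr_ge0 // => j _.
  by rewrite mulr_ge0 // integral_over_ge0.
have pz j : periodic (Z k j) T by apply: Fz_periodic.
have sz j : step_function (Z k j) by apply: Fz_step.
have z0 j t : 0 <= Z k j t by exact: isolated_outflow_ge0.
have bz j : bounded_measurable (Z k j) by exact: (step_bounded_measurable T_gt0).
split => i; rewrite iter_yS.
- exact: total_inflow_periodic.
- exact: total_inflow_step.
- by move=> t; apply: le_trans (lam_ge0 i t) (le_total_inflow _ _ z0).
- rewrite integral_total_inflow //.
  suff : \sum_j rt j i * integral_over 0 T (Z k j) <= \sum_j rt j i * integral_over 0 T (c j).
    by have := stable i; lra.
  apply: ler_sum => j _; rewrite ler_wpM2l // [Z k j]/(Fz _ _ _) integral_Fz //.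
  exact: ltW.
Qed.

Lemma iter_spec k i :
  [/\ periodic (X k i) T, link_solution (Y k i) (c i) 0 T (X k i),
      X k i T = X k i 0 & exists2 t0, 0 <= t0 <= T & X k i t0 = 0].
Proof. by have [py sy _ uy] := iter_y_admissible k; exact: Fx_spec. Qed.

Lemma iter_z_periodic k i : periodic (Z k i) T.
Proof. by have [py sy _ uy] := iter_y_admissible k; exact: Fz_periodic. Qed.

Lemma iter_z_bm k i : bounded_measurable (Z k i).
Proof.
have [py sy _ uy] := iter_y_admissible k.
by apply: (step_bounded_measurable T_gt0); [exact: Fz_periodic|exact: Fz_step].
Qed.

Lemma iter_y_bm k i : bounded_measurable (Y k i).
Proof. by have [py sy _ _] := iter_y_admissible k; exact: (step_bounded_measurable T_gt0). Qed.

Lemma iter_z_ge0 k i t : 0 <= Z k i t.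
Proof. by have [_ _ y0 _] := iter_y_admissible k; exact: isolated_outflow_ge0. Qed.

Lemma iter_x_le k (y x : E -> R -> R) i : (forall t, Y k i t <= y i t) ->
  periodic (x i) T -> link_solution (y i) (c i) 0 T (x i) ->
  (forall t, X k i t <= x i t) /\
  forall t, Z k i t <= isolated_outflow (y i) (c i) (x i) t.
Proof.
move=> Yy px solx; have [pX solX _ [t0 t0T Xt0]] := iter_spec k i.
have Xx := periodic_queue_le T_gt0 Yy pX px solX solx t0T Xt0.
by split => // t; exact: isolated_outflow_mono (Yy t) (Xx t).
Qed.

(** The first inflow is lam and every later one adds nonnegative terms to it;
    larger inflows give larger queues, larger outflows, and larger inflows
    downstream. *)
Lemma iter_mono k i : (forall t, Y k i t <= Y k.+1 i t) /\
  (forall t, X k i t <= X k.+1 i t) /\ (forall t, Z k i t <= Z k.+1 i t).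
Proof.
have step_mono m : (forall j t, Y m j t <= Y m.+1 j t) ->
    forall j, (forall t, X m j t <= X m.+1 j t) /\ (forall t, Z m j t <= Z m.+1 j t).
  move=> YY j; have [pX solX _ _] := iter_spec m.+1 j.
  exact: (iter_x_le (YY j) pX solX).
have Ymono m : forall j t, Y m j t <= Y m.+1 j t.
  elim: m => [|m ih] j t; rewrite !iter_yS.
    by apply: le_total_inflow; exact: iter_z_ge0.
  by apply: total_inflow_le => l; have [] := step_mono m ih l.
by split; [exact: Ymono|exact: step_mono (Ymono k) i].
Qed.

Section Trajectory.
Variables (xs zs : E -> R -> R).
Hypothesis xs_zs : periodic_trajectory rt delta T lam c xs zs.

Let ys := total_inflow zs.

Let traj : trajectory rt delta lam c xs zs. Proof. by case: xs_zs. Qed.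
Let xs_periodic i : periodic (xs i) T. Proof. by case: xs_zs. Qed.
Let zs_periodic i : periodic (zs i) T. Proof. by case: xs_zs. Qed.
Let xs_ge0 : forall i t, 0 <= xs i t := trajectory_queue_ge0 traj.
Let zs_ge0 : forall i t, 0 <= zs i t := trajectory_outflow_ge0 traj.

Lemma trajectory_inflowE i t : delayed_inflow rt delta lam zs i t +
  \sum_(j | instant_upstream rt delta i j) rt j i * zs j t = ys i t.
Proof.
rewrite /delayed_inflow /ys /total_inflow -addrA; congr (_ + _).
rewrite [RHS](bigID (instant_upstream rt delta i)) /= addrC; congr (_ + _).
by apply: eq_bigr => j /andP[_ /eqP ->]; rewrite subr0.
Qed.

(** Together with [trajectory_link_solution]: each queue of the trajectory obeys
    the isolated-link law for its total inflow. *)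
Lemma trajectory_outflowE i : zs i = isolated_outflow (ys i) (c i) (xs i).
Proof.
apply/funext => t; have := lp_outflowE rt_ge0 (trajectory_outflow traj t).
by move=> /(_ (xs_ge0 ^~ t) i); rewrite trajectory_inflowE.
Qed.

Lemma trajectory_link_solution i : link_solution (ys i) (c i) 0 T (xs i).
Proof.
split => //; first exact: (trajectory_ac traj).
apply: (ae_mono (trajectory_ode traj i) _) => t h _.
by rewrite -trajectory_outflowE -trajectory_inflowE.
Qed.

Lemma trajectory_queue_measurable i : measurable_fun setT (xs i).
Proof.
apply: continuous_measurable_fun => t.
apply/cvgrPdist_lt => e e0.
have tI : t - 1 <= t <= t + 1 by rewrite gerBl lerDl ler01.
have [d d0 xd] := ac_continuity (trajectory_ac traj i (t - 1) (t + 1)) tI e0.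
apply/nbhs_ballP; exists (Num.min d 1) => /=; first by rewrite lt_min d0 ltr01.
move=> u; rewrite /ball /= lt_min => /andP[ud u1]; rewrite distrC; apply: xd.
  by move: u1; rewrite ltr_distl => /andP[h1 h2]; apply/andP; split; lra.
by rewrite distrC.
Qed.

Lemma bounded_outflow : exists K, forall i t, c i t <= K.
Proof.
have cK i : exists K, forall t, c i t <= K.
  by have [_ [K cK]] := c_bm i; exists K => t; exact: le_trans (ler_norm _) (cK t).
have /choice[K cKi] := cK; exists (\sum_i `|K i|) => i t.
apply: le_trans (cKi i t) _; rewrite (bigD1 i) //=.
by rewrite (le_trans (ler_norm _)) // lerDl sumr_ge0.
Qed.

(** The trajectory outflow is the fixed point of the map that is iterated here
    from above with the queues kept equal to xs.  Nothing in the definition of a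
    trajectory makes zs measurable, but these iterates are measurable and
    decrease to zs. *)
Fixpoint upper_outflow (n : nat) : E -> R -> R :=
  if n is m.+1 then
    fun i => isolated_outflow (total_inflow (upper_outflow m) i) (c i) (xs i)
  else c.

Lemma upper_outflow_bm n i : bounded_measurable (upper_outflow n i).
Proof.
suff [m b] : measurable_fun setT (upper_outflow n i) /\
    (forall t, 0 <= upper_outflow n i t <= c i t).
  split => //; have [_ [K cK]] := c_bm i; exists K => t.
  have /andP[u0 uc] := b t.
  by rewrite ger0_norm // (le_trans uc) // (le_trans (ler_norm _)).
elim: n i => [|n ih] i.
  by split; [case: (c_bm i)|move=> t; rewrite c_ge0 lexx].
have bm j : bounded_measurable (upper_outflow n j).
  have [m b] := ih j; split => //; have [_ [K cK]] := c_bm j; exists K => t.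
  have /andP[u0 uc] := b t.
  by rewrite ger0_norm // (le_trans uc) // (le_trans (ler_norm _)).
have z0 j t : 0 <= upper_outflow n j t by have [_ /(_ t)/andP[]] := ih j.
split => [|t]; last first.
  rewrite isolated_outflow_le andbT isolated_outflow_ge0 //.
  by apply: le_trans (lam_ge0 i t) (le_total_inflow _ _ z0).
rewrite /= /isolated_outflow; apply: measurable_fun_ifT => //.
- by apply: measurable_fun_ltr => //; exact: trajectory_queue_measurable.
- by case: (c_bm i).
- by apply: measurable_minr; [case: (c_bm i)|case: (total_inflow_bm i bm)].
Qed.

Lemma upper_outflow_ge n i t : zs i t <= upper_outflow n i t.
Proof.
elim: n i t => [|n ih] i t; first by rewrite trajectory_outflowE isolated_outflow_le.
rewrite trajectory_outflowE; apply: isolated_outflow_mono => //.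
exact: total_inflow_le.
Qed.

Lemma upper_outflow_dec n i t : upper_outflow n.+1 i t <= upper_outflow n i t.
Proof.
elim: n i t => [|n ih] i t; first exact: isolated_outflow_le.
by apply: isolated_outflow_mono => //; exact: total_inflow_le.
Qed.

Lemma total_inflowB (z z' : E -> R -> R) i t :
  total_inflow z i t - total_inflow z' i t =
  \sum_j rt j i * (z j (t - delta j i) - z' j (t - delta j i)).
Proof.
rewrite /total_inflow opprD addrACA subrr add0r -sumrB.
by apply: eq_bigr => j _; rewrite mulrBr.
Qed.

Lemma upper_outflow_cvg i t : upper_outflow n i t @[n --> \oo] --> zs i t.
Proof.
have [K cK] := bounded_outflow.
suff : (upper_outflow n i t - zs i t) @[n --> \oo] --> (0 : R).
  by move/subr_cvg0.
have Udec m j u : nonincreasing_seq (fun n => upper_outflow n j u - zs j u).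
  by apply/nonincreasing_seqP => n; rewrite lerD2r upper_outflow_dec.
apply: (@delayed_routing_limit _ _ _ rt_substochastic rt_out delta
  (fun n i t => upper_outflow n i t - zs i t) K).
- move=> n j u; rewrite subr_ge0 upper_outflow_ge /=.
  apply: le_trans (cK j u); rewrite lerBlDr.
  have : upper_outflow n j u <= c j u.
    by case: n => [|n] //=; exact: isolated_outflow_le.
  by have := zs_ge0 j u; lra.
- by move=> j u; exact: Udec.
- move=> j u; left; exists 0%N => n _; rewrite -total_inflowB /=.
  rewrite [X in _ - X <= _](_ : _ = isolated_outflow (ys j) (c j) (xs j) u); last first.
    by rewrite -trajectory_outflowE.
  by apply: isolated_outflowB_le; apply: total_inflow_le => l v; exact: upper_outflow_ge.
Qed.

Lemma trajectory_outflow_bm i : bounded_measurable (zs i).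
Proof.
split.
  apply: (@measurable_fun_cvg _ _ _ setT (fun n => upper_outflow n i)) => [n|t _].
    by case: (upper_outflow_bm n i).
  exact: upper_outflow_cvg.
have [_ [K cK]] := c_bm i; exists K => t; rewrite ger0_norm //.
rewrite trajectory_outflowE (le_trans (isolated_outflow_le _ _ _ _)) //.
exact: le_trans (ler_norm _) (cK t).
Qed.

Let ys_bm i : bounded_measurable (ys i).
Proof. by apply: total_inflow_bm => j; exact: trajectory_outflow_bm. Qed.

Lemma trajectory_conservation i : integral_over 0 T (zs i) = integral_over 0 T (ys i).
Proof.
rewrite trajectory_outflowE; apply: (periodic_queue_conservation T_gt0) => //.
- by rewrite -trajectory_outflowE; exact: trajectory_outflow_bm.
- exact: trajectory_link_solution.
- by rewrite -{1}[T]add0r xs_periodic.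
Qed.

(** A queue that is never empty discharges at capacity, so the deficit d i of
    its outflow with respect to its capacity would be 0; but the stability
    condition says that d exceeds R^T d, which is nonnegative. *)
Lemma trajectory_queue_empties i : exists2 t0, 0 <= t0 <= T & xs i t0 = 0.
Proof.
apply: contrapT => never.
have zc t : 0 <= t <= T -> zs i t = c i t.
  move=> tT; rewrite trajectory_outflowE isolated_outflow_busy //.
  by rewrite lt_neqAle xs_ge0 andbT; apply/eqP => xt; apply: never; exists t.
pose d j := integral_over 0 T (c j) - integral_over 0 T (zs j).
have d0 j : 0 <= d j.
  rewrite subr_ge0 le_integral_over //; first exact: trajectory_outflow_bm.
  by move=> t _; rewrite trajectory_outflowE isolated_outflow_le.
have di : d i = 0 by rewrite /d (eq_integral_over zc) subrr.
have : \sum_j rt j i * d j < d i.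
  have -> : \sum_j rt j i * d j = \sum_j rt j i * integral_over 0 T (c j) -
      \sum_j rt j i * integral_over 0 T (zs j).
    by rewrite -sumrB; apply: eq_bigr => j _; rewrite mulrBr.
  have := stable i; rewrite /d trajectory_conservation integral_total_inflow //.
    by set A := \sum_j _; set B := \sum_j _; lra.
  exact: trajectory_outflow_bm.
by rewrite di ltNge sumr_ge0 // => j _; rewrite mulr_ge0.
Qed.

Lemma iter_le_trajectory k i : (forall t, Y k i t <= ys i t) /\
  (forall t, X k i t <= xs i t) /\ (forall t, Z k i t <= zs i t).
Proof.
have bound m : (forall j t, Y m j t <= ys j t) ->
    forall j, (forall t, X m j t <= xs j t) /\ (forall t, Z m j t <= zs j t).
  move=> Yys j; rewrite trajectory_outflowE.
  exact: (iter_x_le (y := ys) (Yys j) (xs_periodic j) (trajectory_link_solution j)).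
have Yys m : forall j t, Y m j t <= ys j t.
  elim: m => [|m ih] j t; first exact: le_total_inflow.
  by rewrite iter_yS; apply: total_inflow_le => l; have [] := bound m ih l.
by split => //; exact: bound.
Qed.

(** The outflow volume over a period that the k-th iterate still misses. *)
Let gap k i := integral_over 0 T (zs i) - integral_over 0 T (Z k i).

Let gapE k i : gap k i = integral_over 0 T (ys i) - integral_over 0 T (Y k i).
Proof.
rewrite /gap trajectory_conservation; congr (_ - _).
by have [py sy _ uy] := iter_y_admissible k; exact: integral_Fz.
Qed.

(** By conservation the missing outflow is the missing inflow, which is routed
    from the missing outflow of the previous iterate. *)
Let gapS k i : gap k.+1 i = \sum_j rt j i * gap k j.
Proof.
rewrite gapE iter_yS !integral_total_inflow //.
- rewrite opprD addrACA subrr add0r -sumrB.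
  by apply: eq_bigr => j _; rewrite mulrBr.
- exact: trajectory_outflow_bm.
- by move=> j; exact: iter_z_periodic.
- by move=> j; exact: iter_z_bm.
Qed.

Let gap_ge0 k i : 0 <= gap k i.
Proof.
rewrite subr_ge0 le_integral_over //; first exact: iter_z_bm.
  exact: trajectory_outflow_bm.
by move=> t _; have [_ []] := iter_le_trajectory k i.
Qed.

Let gap_cvg i : gap k i @[k --> \oo] --> (0 : R).
Proof.
have gap_dec j : nonincreasing_seq (gap ^~ j).
  apply/nonincreasing_seqP => k; rewrite lerD2l lerN2.
  apply: le_integral_over; [exact: iter_z_bm|exact: iter_z_bm|].
  by move=> t _; have [_ []] := iter_mono k j.
pose L j := limn (gap ^~ j).
have gL j : gap k j @[k --> \oo] --> L j.
  apply: nonincreasing_is_cvgn; first exact: gap_dec.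
  by exists 0 => _ [k _ <-].
suff L0 : forall j, L j = 0 by rewrite -(L0 i); exact: gL.
apply: (routing_contraction rt_substochastic rt_out) => j.
  by apply: limr_ge; [exact: gL|apply: nearW => k].
have gS : gap k.+1 j @[k --> \oo] --> L j by rewrite (@cvg_shiftS _ (gap ^~ j)); exact: gL.
rewrite (cvg_unique _ gS (_ : gap k.+1 j @[k --> \oo] --> \sum_l rt l j * L l)) //.
rewrite (_ : (fun k => gap k.+1 j) = (fun k => \sum_l rt l j * gap k l)).
  exact: routed_sum_cvg.
by apply/funext => k; rewrite gapS.
Qed.

(** Both queues are empty at an instant t0 at which xs is.  From t0 to t their
    difference changes by the missing inflow minus the missing outflow, both
    between 0 and the gap. *)
Lemma queue_distance k i t : 0 <= t <= T -> 0 <= xs i t - X k i t <= gap k i.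
Proof.
move=> tT; have [Yys [Xxs Zzs]] := iter_le_trajectory k i.
rewrite subr_ge0 Xxs /=.
have [t0 t0T xt0] := trajectory_queue_empties i.
have [pX solX XT _] := iter_spec k i.
have Xt0 : X k i t0 = 0.
  by apply/eqP; rewrite eq_le (link_ge0 solX) // andbT -xt0 Xxs.
have increment (s u : R) : 0 <= s -> s <= u -> u <= T ->
    `|(xs i u - X k i u) - (xs i s - X k i s)| <= gap k i.
  move=> s0 su uT.
  have sols := link_solution_sub s0 uT (trajectory_link_solution i).
  have solk := link_solution_sub s0 uT solX.
  have odes := link_ode sols; rewrite -trajectory_outflowE in odes.
  have odek := link_ode solk.
  have Is := ac_integral su (bounded_measurableB (ys_bm i) (trajectory_outflow_bm i)) (link_ac sols) odes.
  have Ik := ac_integral su (bounded_measurableB (iter_y_bm k i) (iter_z_bm k i)) (link_ac solk) odek.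
  have sub (f g : R -> R) : bounded_measurable f -> bounded_measurable g ->
      (forall v, g v <= f v) ->
      0 <= integral_over s u f - integral_over s u g <=
        integral_over 0 T f - integral_over 0 T g.
    move=> bf bg gf; have bfg := bounded_measurableB bf bg.
    rewrite -!integral_overB // integral_over_ge0 /=; last by move=> v _; rewrite subr_ge0.
    rewrite (integral_over_split bfg (le_trans s0 su) uT) (integral_over_split bfg s0 su).
    have : 0 <= integral_over 0 s (fun v => f v - g v).
      by apply: integral_over_ge0 => v _; rewrite subr_ge0.
    have : 0 <= integral_over u T (fun v => f v - g v).
      by apply: integral_over_ge0 => v _; rewrite subr_ge0.
    lra.
  have /andP[z1 z2] := sub _ _ (trajectory_outflow_bm i) (iter_z_bm k i) Zzs.
  have /andP[y1 y2] := sub _ _ (ys_bm i) (iter_y_bm k i) Yys.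
  rewrite -/(gap k i) in z2; rewrite -gapE in y2.
  rewrite !integral_overB in Is Ik; try by [exact: ys_bm|exact: iter_y_bm|
    exact: trajectory_outflow_bm|exact: iter_z_bm].
  by rewrite ler_norml; apply/andP; split; lra.
have /andP[t00 t0T'] := t0T; have /andP[t_0 tT'] := tT.
have [tt0|t0t] := leP t t0.
  have := increment t t0 t_0 tt0 t0T'; rewrite xt0 Xt0 subrr sub0r normrN.
  exact: le_trans (ler_norm _).
have := increment t0 t t00 (ltW t0t) tT'; rewrite xt0 Xt0 subrr subr0.
exact: le_trans (ler_norm _).
Qed.

Lemma queue_cvg i t : X k i t @[k --> \oo] --> xs i t.
Proof.
suff cvg_itv u : 0 <= u <= T -> X k i u @[k --> \oo] --> xs i u.
  rewrite -(periodic_phase t (xs_periodic i)).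
  rewrite (_ : (fun k => X k i t) = (fun k => X k i (phase T t))).
    by apply: cvg_itv; have /andP[-> /ltW] := phase_itv T_gt0 t.
  by apply/funext => k; rewrite periodic_phase //; have [] := iter_spec k i.
move=> uT; apply/subr_cvg0; apply/cvgrPdist_le => e e0.
have /cvgrPdist_le/(_ e e0) := gap_cvg i; apply: filterS => k.
rewrite !sub0r !normrN ger0_norm // => gk; rewrite distrC.
by have /andP[d0 dg] := queue_distance k i uT; rewrite ger0_norm // (le_trans dg).
Qed.

Lemma iter_x_ge0 k i t : 0 <= X k i t.
Proof.
have [pX solX _ _] := iter_spec k i; rewrite -(periodic_phase t pX).
by apply: (link_ge0 solX); have /andP[-> /ltW] := phase_itv T_gt0 t.
Qed.

(** Where xs is positive, the iterated queue is eventually positive too, and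
    both outflows are equal to the capacity.  Where xs vanishes, so do all the
    iterated queues, and the outflow defect is at most the inflow defect. *)
Lemma outflow_cvg i t : Z k i t @[k --> \oo] --> zs i t.
Proof.
have [K cK] := bounded_outflow.
suff : (zs i t - Z k i t) @[k --> \oo] --> (0 : R).
  move=> h; rewrite -[zs i t]subr0.
  rewrite (_ : (fun k => Z k i t) = (fun k => zs i t - (zs i t - Z k i t))).
    by apply: cvgB h; exact: cvg_cst.
  by apply/funext => k; rewrite subKr.
apply: (@delayed_routing_limit _ _ _ rt_substochastic rt_out delta
  (fun k i t => zs i t - Z k i t) K).
- move=> k j u; have [_ [_ Zzs]] := iter_le_trajectory k j.
  rewrite subr_ge0 Zzs /=; apply: le_trans (cK j u).
  have : zs j u <= c j u by rewrite trajectory_outflowE isolated_outflow_le.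
  by have := iter_z_ge0 k j u; lra.
- move=> j u; apply/nonincreasing_seqP => k; rewrite lerD2l lerN2.
  by have [_ [_]] := iter_mono k j; apply.
- move=> j u; have [xu|xu] := ltP 0 (xs j u).
    right; have /cvgr_gt/(_ _ xu) [N _ XN] := @queue_cvg j u.
    exists N => n Nn; rewrite trajectory_outflowE isolated_outflow_busy //.
    by rewrite [Z n j u](isolated_outflow_busy _ _ (XN n Nn)) subrr.
  left; exists 0%N => n _.
  have xs0 : xs j u = 0 by apply/eqP; rewrite eq_le xu xs_ge0.
  have X0 : X n.+1 j u = 0.
    by apply/eqP; rewrite eq_le iter_x_ge0 andbT -xs0; have [_ [->]] := iter_le_trajectory n.+1 j.
  rewrite -total_inflowB -/ys -iter_yS trajectory_outflowE.
  have -> : Z n.+1 j u = isolated_outflow (Y n.+1 j) (c j) (xs j) u.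
    rewrite (_ : Z n.+1 j u = isolated_outflow (Y n.+1 j) (c j) (X n.+1 j) u) //.
    by rewrite /isolated_outflow X0 xs0.
  by apply: isolated_outflowB_le; have [] := iter_le_trajectory n.+1 j.
Qed.

End Trajectory.
End Network.

(** * Convergence of the network algorithm *)

Theorem mainTheorem5 (R : realType) (V E : finType) (tail head : E -> V)
  (loopless : forall e : E, tail e != head e)
  (rt delta : E -> E -> R)
  (rt_routing : routing_matrix tail head rt)
  (rt_substochastic : substochastic rt)
  (connected_links : link_connected tail head)
  (connected_out : out_connected rt)
  (delta_ge0 : forall j i : E, 0 <= delta j i)
  (T : R) (T_gt0 : 0 < T)
  (lam c : E -> R -> R)
  (lam_periodic : forall i : E, periodic (lam i) T)
  (c_periodic : forall i : E, periodic (c i) T)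
  (lam_ge0 : forall (i : E) (t : R), 0 <= lam i t)
  (c_ge0 : forall (i : E) (t : R), 0 <= c i t)
  (lam_pc : forall i : E, piecewise_constant T (lam i))
  (c_pc : forall i : E, piecewise_constant T (c i))
  (stable : stability_condition rt T lam c)
  (xs zs : E -> R -> R)
  (xs_zs : periodic_trajectory rt delta T lam c xs zs) :
  forall (i : E) (t : R), 0 <= t <= T ->
    [/\ nondecreasing_seq (fun k : nat => iter_x rt delta T lam c k i t),
        nondecreasing_seq (fun k : nat => iter_z rt delta T lam c k i t),
        (fun k : nat => iter_x rt delta T lam c k i t) @ \oo --> xs i t
      & (fun k : nat => iter_z rt delta T lam c k i t) @ \oo --> zs i t].
Proof.
have lam_step i := piecewise_constant_step T_gt0 (lam_periodic i) (lam_pc i).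
have c_step i := piecewise_constant_step T_gt0 (c_periodic i) (c_pc i).
have stable' i : integral_over 0 T (lam i) <
    integral_over 0 T (c i) - \sum_j rt j i * integral_over 0 T (c j).
  have [eps eps0 /(_ i)] := stable; rewrite /mean => h.
  rewrite -(ltr_pM2l (_ : 0 < T^-1)) ?invr_gt0 // mulrBr mulr_sumr.
  under eq_bigr do rewrite mulrCA.
  by apply: le_lt_trans h; rewrite lerDl ltW.
have mono k i := iter_mono delta rt_substochastic T_gt0 lam_periodic c_periodic
  lam_ge0 c_ge0 lam_step c_step stable' k i.
move=> i t _; split.
- by apply/nondecreasing_seqP => k; have [_ [h _]] := mono k i.
- by apply/nondecreasing_seqP => k; have [_ [_ h]] := mono k i.
- exact: (queue_cvg rt_substochastic connected_out T_gt0 lam_periodic c_periodic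
    lam_ge0 c_ge0 lam_step c_step stable' xs_zs).
- exact: (outflow_cvg rt_substochastic connected_out T_gt0 lam_periodic c_periodic
    lam_ge0 c_ge0 lam_step c_step stable' xs_zs).
Qed.
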